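(* Let $\xi_0,\xi_1,\xi_2,\ldots$ be independent and identically distributed real random variables, and for $n\ge1$ let $\mathcal{C}_n$ be the $n\times n$ random circulant matrix whose $(i,j)$ entry, for $0\le i,j\le n-1$, is $\xi_{(j-i)\bmod n}$. Suppose $\xi_0$ satisfies condition (H): there exist $M>0$ and $q\in(0,1)$ with $\sup_{u\in\mathbb{R}}\mathbb{P}(|\xi_0-u|\le1)\le 1-q$ and $\mathbb{P}(|\xi_0|>M)\le q/2$. (1) If in addition $\xi_0$ has zero mean, finite positive variance, and a moment generating function that exists on an open interval around zero, then for any $\varepsilon>0$ and $\rho\in(0,1/4)$, for all large $n$, \[ \mathbb{P}\left(\kappa(\mathcal{C}_n)\le \frac{C_0}{\varepsilon}n^{\rho+1/2}(\log n)^{1/2}\right)\ge 1-C_1\left((\varepsilon^2+\varepsilon)n^{-2\rho}+n^{-1/2+o(1)}\right), \] where $C_0,C_1>0$ depend only on the distribution of $\xi_0$. (2) If instead $\xi_0$ has zero mean and $\mathbb{E}[\xi_0^2]<\infty$, then for any $\varepsilon>0$ and $\rho\in(0,1/4)$, for all large $n$, \[ \mathbb{P}\left(\kappa(\mathcal{C}_n)\le \frac{C_0}{\varepsilon}n^{\rho+1/2}\log n\right)\ge 1-C_2\left((\varepsilon^2+\varepsilon)n^{-2\rho}+(\log n)^{-1/2}\right), \] where $C_0,C_2>0$ depend only on the distribution of $\xi_0$.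
   Context: For a square matrix $A$, $\kappa(A)=\sigma_{\max}(A)/\sigma_{\min}(A)$ is its condition number (largest over smallest singular value; taken as $+\infty$ if $A$ is singular). The notation $n^{-1/2+o(1)}$ means $n^{-1/2+\delta_n}$ for some sequence $\delta_n\to0$. *)

(* Defs.v *)
From HB Require Import structures.
From mathcomp Require Import all_boot all_order all_algebra.
From mathcomp Require Import all_classical all_reals all_analysis.
Set Implicit Arguments. Unset Strict Implicit. Unset Printing Implicit Defensive.
Import Order.TTheory GRing.Theory Num.Theory.
Import numFieldNormedType.Exports.
Local Open Scope classical_set_scope.
Local Open Scope ring_scope.

Definition circulant (R : pzRingType) (n : nat) (x : nat -> R) : 'M[R]_n :=
  \matrix_(i < n, j < n) x ((j + n - i) %% n)%N.

(* Singular values of a real square matrix A are the square roots of the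
   eigenvalues of A^T A. *)
Definition sigma_max (R : realType) (n : nat) (A : 'M[R]_n) : R :=
  Num.sqrt (sup [set l : R | eigenvalue (A^T *m A) l]).
Definition sigma_min (R : realType) (n : nat) (A : 'M[R]_n) : R :=
  Num.sqrt (inf [set l : R | eigenvalue (A^T *m A) l]).

Definition kappa (R : realType) (n : nat) (A : 'M[R]_n) : \bar R :=
  if sigma_min A == 0 then +oo%E else (sigma_max A / sigma_min A)%:E.

(* Mutual independence + identical distribution of a sequence of real
   random variables (product rule over every finite family; taking
   B i = setT for unused indices covers arbitrary finite subfamilies). *)
Definition iid_seq (R : realType) (d : measure_display) (T : measurableType d)
  (P : probability T R) (X : nat -> {RV P >-> R}) : Prop :=
  (forall (n : nat) (B : nat -> set R), (forall i, measurable (B i)) ->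
     P (\big[setI/setT]_(i < n) (X i @^-1` B i))
     = (\prod_(i < n) P (X i @^-1` B i))%E) /\
  (forall (k : nat) (B : set R), measurable B ->
     P (X k @^-1` B) = P (X 0%N @^-1` B)).

Definition condH (R : realType) (d : measure_display) (T : measurableType d)
  (P : probability T R) (Y : {RV P >-> R}) : Prop :=
  exists (M q : R), 0 < M /\ 0 < q < 1 /\
    (forall u : R, P [set w | (`|Y w - u| <= 1)%R] <= (1 - q)%:E)%E /\
    (P [set w | (M < `|Y w|)%R] <= (q / 2)%:E)%E.

(* Main.v *)
(** Write [lam_k = sum_j xi_j exp (2 pi i j k / n)]. The squared singular values of
    the circulant matrix are the numbers [|lam_k|^2], so it suffices to bound
    [max_k |lam_k|] from above and [min_k |lam_k|] from below.

    Upper bound: Chernoff's method at [t = sqrt (ln n / n)] under the exponential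
    moment hypothesis; under a second moment, the same method at [t = 1 / sqrt n]
    for the variables truncated at [sqrt n], the discarded part being at most
    [sum_j xi_j^2 / sqrt n], which Markov's inequality controls.

    Lower bound: the indicator of [|lam_k| <= t] is dominated by a Fejer kernel on
    the grid of mesh [1 / sqrt n] with [N ~ sqrt n / t] points in each direction,
    so only finitely many values of the characteristic function of [lam_k] occur.
    Their squared modulus is at most
    [exp (- E (sum_j (1 - cos (c_j (xi_0 - xi_1)))))], where [c_j] is the value at
    the angle [2 pi j k / n] of a linear form in the cosine and the sine.
    The sum is bounded below by comparing this form with a translate of it whose
    difference has norm of order one; such a translate exists as soon as the order
    [d = n / gcd (k, n)] exceeds a multiple of [1 / t], and then the probability is
    [O(t^2 / n)]. At most [O(1 / t^2)] frequencies have a smaller order; for these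
    the bound [O(1 / n)] at scale one suffices, except for the at most two real
    eigenvalues, which contribute [O(1 / sqrt n)]. Altogether the lower bound fails
    with probability [O(t^2 + 1 / sqrt n)] when [t >= n ^ (- 1 / 4)], so
    [delta = 0] works in the first part. *)

Require Import Defs.
From HB Require Import structures.
From mathcomp Require Import all_boot all_order all_algebra.
From mathcomp Require Import all_classical all_reals all_analysis.
From mathcomp Require Import measurable_realfun.
From mathcomp Require Import zify ring lra.
Import Order.TTheory GRing.Theory Num.Theory.
Import numFieldNormedType.Exports.
Set Implicit Arguments. Unset Strict Implicit. Unset Printing Implicit Defensive.
Local Open Scope classical_set_scope.
Local Open Scope ring_scope.

Section elementary_inequalities.
Context {R : realType}.
Implicit Types x y : R.

Lemma eq_ler x y : x = y -> x <= y.
Proof. by move=> ->. Qed.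

Lemma sin_mean_value x : exists2 c, c ^+ 2 <= x ^+ 2 & sin x = x * cos c.
Proof.
wlog x_ge0 : x / 0 <= x => [nonneg|].
  have [/nonneg //|/ltW x_le0] := leP 0 x.
  have [|c cx sinE] := nonneg (- x); first by rewrite oppr_ge0.
  exists c; first by rewrite -(sqrrN x).
  by rewrite -[x in LHS]opprK sinN sinE mulNr opprK.
have [|c] := @MVT_segment R sin cos 0 x x_ge0.
  by apply: continuous_subspaceT => y; exact: continuous_sin.
rewrite in_itv/= => /andP[c_ge0 cx]; rewrite sin0 !subr0 => ->.
by exists c; [rewrite ler_sqr | rewrite mulrC].
Qed.

Lemma cos_half_angle x : cos x = 1 - 2 * sin (x / 2) ^+ 2.
Proof.
have {1}-> : x = x / 2 *+ 2 by rewrite -mulr_natr; field.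
by rewrite cos_mulr2n sin2cos2; ring.
Qed.

Lemma one_minus_cos_le x : 1 - cos x <= x ^+ 2 / 2.
Proof.
rewrite cos_half_angle; have [c _ ->] := sin_mean_value (x / 2).
have cos2_le1 : cos c ^+ 2 <= 1 by rewrite cos2sin2 gerBl sqr_ge0.
have := sqr_ge0 x; rewrite exprMn; nra.
Qed.

Lemma one_minus_cos_ge x : x ^+ 2 <= 1 -> x ^+ 2 / 4 <= 1 - cos x.
Proof.
move=> x2_le1; rewrite cos_half_angle.
have [c c2_le ->] := sin_mean_value (x / 2).
have cosc_ge : 7 / 8 <= cos c.
  by have := one_minus_cos_le c; rewrite exprMn in c2_le; lra.
have cosc2_ge : 49 / 64 <= cos c ^+ 2 by nra.
have := sqr_ge0 x; rewrite exprMn; nra.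
Qed.

Lemma one_minus_cosB x y : 1 - cos (x - y) <= 2 * (1 - cos x) + 2 * (1 - cos y).
Proof.
rewrite cosB.
have := cos2Dsin2 x; have := cos2Dsin2 y.
have := sqr_ge0 (cos x + cos y - 2); have := sqr_ge0 (sin x + sin y); nra.
Qed.

Lemma expR_le_quadratic x : expR x <= 1 + x + x ^+ 2 * expR `|x|.
Proof.
have expRB1_le : expR x - 1 <= x * expR x.
  have := expR_ge1Dx (- x); rewrite -(ler_pM2r (expR_gt0 x)) [leRHS]mulrC.
  by rewrite expRxMexpNx_1; lra.
have := expR_ge1Dx x.
have [x_ge0|x_lt0] := leP 0 x; first by rewrite ger0_norm//; nra.
have expR_norm_ge1 : 1 <= expR `|x| by rewrite -expR0 ler_expR.
have : expR x <= 1 by rewrite expR_le1 ltW.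
have := sqr_ge0 x; nra.
Qed.

Lemma sqr_le_expR x : 0 <= x -> x ^+ 2 <= 2 * expR x.
Proof. by move=> /(expR_ge1Dxn 1); rewrite (_ : 2`! = 2)%N//; lra. Qed.

Lemma expRN_le_sqr x : 0 < x -> expR (- x) <= 2 / x ^+ 2.
Proof.
move=> x_gt0; rewrite expRN ler_pdivlMr ?exprn_gt0// mulrC.
by rewrite ler_pdivrMr ?expR_gt0// sqr_le_expR ?ltW.
Qed.

Lemma exists_nat_half_le x : 1 <= x -> exists2 N, (0 < N)%N & x / 2 <= N%:R <= x.
Proof.
move=> x_ge1; have /truncn_itv/andP[le_x] : 0 <= x by lra.
rewrite -natr1 => x_lt; exists (Num.truncn x); first by rewrite truncn_gt0.
have : 1 <= (Num.truncn x)%:R :> R by rewrite ler1n truncn_gt0.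
by rewrite le_x andbT; move: x_lt; move: (_%:R) => y; lra.
Qed.

End elementary_inequalities.

Section asymptotics.
Context {R : realType}.

Lemma natr_eventually (K : R) : exists N : nat, forall n : nat, (N <= n)%N -> K <= n%:R.
Proof.
exists (Num.truncn `|K|).+1 => n N_le; apply: (le_trans (ler_norm K)).
have /truncn_itv/andP[_ /ltW le_trunc] := normr_ge0 K.
by apply: le_trans le_trunc _; rewrite ler_nat.
Qed.

Lemma powR_natr_eventually (a K : R) : 0 < a ->
  exists N : nat, forall n : nat, (N <= n)%N -> K <= n%:R `^ a.
Proof.
move=> a_gt0; have [N root_le] := natr_eventually (`|K| `^ a^-1).
exists N => n /root_le root_le_n; apply: (le_trans (ler_norm K)).
have -> : `|K| = (`|K| `^ a^-1) `^ a by rewrite -powRrM mulVf ?gt_eqF// powRr1.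
by apply: ge0_ler_powR; rewrite ?nnegrE ?powR_ge0//; exact: ltW.
Qed.

Lemma sqrt_natr_eventually (K : R) :
  exists N : nat, forall n : nat, (N <= n)%N -> K <= Num.sqrt n%:R.
Proof.
have half_gt0 : 0 < 1 / 2 :> R by lra.
have [N K_le] := powR_natr_eventually K half_gt0.
by exists N => n /K_le; rewrite div1r powR12_sqrt.
Qed.

Lemma powR_neg_half n : n%:R `^ (- (1 / 2)) = (Num.sqrt n%:R)^-1 :> R.
Proof. by rewrite powRN div1r powR12_sqrt. Qed.

Lemma ln_natr_le_sqrt n : ln n%:R <= 2 * Num.sqrt n%:R :> R.
Proof.
case: n => [|n]; first by rewrite ln0// sqrtr0 mulr0.
set r := Num.sqrt _; have r_gt0 : 0 < r by rewrite sqrtr_gt0 ltr0n.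
have -> : n.+1%:R = r ^+ 2 :> R by rewrite sqr_sqrtr.
by rewrite lnXn// -[leLHS]mulr_natl ler_pM2l// ltW// ln_sublinear.
Qed.

Lemma mul_expRN2_ln_le n : (0 < n)%N ->
  n%:R * expR (- (2 * ln n%:R)) <= (Num.sqrt n%:R)^-1 :> R.
Proof.
move=> n_gt0; have nR : 0 < n%:R :> R by rewrite ltr0n.
have r_gt0 : 0 < Num.sqrt n%:R :> R by rewrite sqrtr_gt0.
rewrite expRN expRM_natl lnK ?posrE// expr2 invfM mulrA divff ?gt_eqF// mul1r.
rewrite lef_pV2 ?posrE// -[leRHS]sqr_sqrtr ?(ltW nR)// expr2 ler_peMl ?(ltW r_gt0)//.
by rewrite -[leLHS]sqrtr1 ler_wsqrtr// ler1n.
Qed.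

Lemma sqrt_ln_ratio_eventually (a : R) : 0 < a -> exists N : nat, forall n : nat,
  (1 < n)%N -> (N <= n)%N -> 0 < Num.sqrt (ln (n%:R : R)) / Num.sqrt n%:R <= a.
Proof.
move=> a_gt0; have [N N_le] := sqrt_natr_eventually (2 / a ^+ 2).
exists N => n n_gt1 /N_le; have n_gt0 : 0 < n%:R :> R by rewrite ltr0n ltnW.
have ln_gt0 : 0 < ln n%:R :> R by rewrite ln_gt0// ltr1n.
set r := Num.sqrt n%:R.
have r_gt0 : 0 < r by rewrite sqrtr_gt0.
rewrite ler_pdivrMr ?exprn_gt0// => le_ra2.
rewrite divr_gt0 ?sqrtr_gt0//= ler_pdivrMr//.
rewrite -[a * r]ger0_norm ?(mulr_ge0 (ltW a_gt0) (ltW r_gt0))// -sqrtr_sqr ler_wsqrtr//.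
rewrite exprMn (le_trans (ln_natr_le_sqrt n))// -/r.
by rewrite [r ^+ 2]expr2 mulrA ler_pM2r// mulrC.
Qed.

Lemma ln_natr_ge1_eventually :
  exists N : nat, forall n : nat, (N <= n)%N -> 1 <= ln n%:R :> R.
Proof.
have [N e_le] := natr_eventually (expR 1).
exists N => n /e_le e_le_n.
by rewrite -[leLHS]expRK ler_ln ?posrE ?expR_gt0// (lt_le_trans (expR_gt0 1)).
Qed.

Lemma scale_eventually (eps rho : R) : 0 < eps -> 0 < rho < 1 / 4 ->
  exists N : nat, forall n : nat, (N <= n)%N -> (0 < n)%N ->
  0 < eps * n%:R `^ (- rho) <= 1 /\
  1 <= (eps * n%:R `^ (- rho)) ^+ 2 * Num.sqrt n%:R.
Proof.
move=> eps_gt0 /andP[rho_gt0 rho_lt].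
have [N1 eps_le] := powR_natr_eventually eps rho_gt0.
have exponent_gt0 : 0 < 1 / 2 - 2 * rho by lra.
have [N2 epsV_le] := powR_natr_eventually (eps ^- 2) exponent_gt0.
exists (maxn N1 N2) => n; rewrite geq_max => /andP[N1_le N2_le] n_gt0.
have nR : 0 < n%:R :> R by rewrite ltr0n.
have pow_gt0 a : 0 < n%:R `^ a :> R by rewrite powR_gt0.
split; first by rewrite mulr_gt0//= powRN ler_pdivrMr// mul1r eps_le.
have -> : (eps * n%:R `^ (- rho)) ^+ 2 * Num.sqrt n%:R =
    eps ^+ 2 * n%:R `^ (1 / 2 - 2 * rho).
  rewrite exprMn -mulrA; congr (_ * _).
  rewrite -powR_mulrn ?powR_ge0// -powRrM -powR12_sqrt ?(ltW nR)//.
  rewrite -powRD; last by rewrite pnatr_eq0 -lt0n n_gt0 implybT.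
  by congr (_ `^ _); lra.
rewrite -ler_pdivrMl ?exprn_gt0// mulr1; exact: epsV_le.
Qed.

Lemma scaled_threshold n (A eps rho L : R) : (0 < n)%N -> 0 < eps ->
  A / eps * n%:R `^ (rho + 1 / 2) * L * (eps * n%:R `^ (- rho)) =
  A * (Num.sqrt n%:R * L).
Proof.
move=> n_gt0 eps_gt0; have nR : 0 < n%:R :> R by rewrite ltr0n.
have pow_gt0 : 0 < n%:R `^ rho :> R by rewrite powR_gt0.
rewrite powRD; last by rewrite pnatr_eq0 -lt0n n_gt0 implybT.
rewrite powRN div1r powR12_sqrt; last exact: ltW.
by field; rewrite !gt_eqF.
Qed.

End asymptotics.

Section periodic_sums.
Context {R : realType}.
Implicit Types (n k j m : nat) (phi : R).

Lemma sum_shift_periodic n (F : nat -> R) i :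
  (forall j, F (j + n)%N = F j) -> \sum_(j < n) F (j + i)%N = \sum_(j < n) F j.
Proof.
move=> per; elim: i => [|i <-]; first by under eq_bigr do rewrite addn0.
case: n per => [|n] per; first by rewrite !big_ord0.
rewrite big_ord_recr/= [RHS]big_ord_recl/= addrC add0n addnS -addSn addnC per.
by congr (_ + _); apply: eq_bigr => j _; rewrite /bump/= add1n addnS addSn.
Qed.

Definition theta n k : R := pi *+ 2 * k%:R / n%:R.

Lemma theta_swap n k j : theta n k * j%:R = theta n j * k%:R.
Proof. by rewrite /theta; ring. Qed.

Lemma theta_double n k j : theta n k.*2 * j%:R = theta n k * j%:R *+ 2.
Proof. by rewrite /theta -muln2 natrM -mulr_natr; ring. Qed.

(* For [n = 0] both sides agree because division by zero gives [theta 0 k = 0]. *)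
Lemma cos_thetaD n k j phi :
  cos (theta n k * (j + n)%:R + phi) = cos (theta n k * j%:R + phi).
Proof.
case: n => [|n]; first by rewrite addn0.
have full_turns : theta n.+1 k * n.+1%:R = pi *+ 2 *+ k.
  by rewrite /theta divfK ?pnatr_eq0// mulr_natr.
by rewrite natrD mulrDr addrAC full_turns (periodicn (@cosD2pi R)).
Qed.

Lemma sin_thetaD n k j phi :
  sin (theta n k * (j + n)%:R + phi) = sin (theta n k * j%:R + phi).
Proof. by rewrite -!cosBpihalf -!addrA cos_thetaD. Qed.

Lemma cos_theta_neq1 n k : (0 < n)%N -> ~~ (n %| k)%N -> cos (theta n k) != 1.
Proof.
move=> n_gt0; rewrite /dvdn -lt0n => r_gt0.
have -> : cos (theta n k) = cos (theta n (k %% n)).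
  rewrite {1}(divn_eq k n) -[RHS](periodicn (@cosD2pi R) (k %/ n)); congr cos.
  by rewrite /theta natrD natrM -mulr_natr; field; rewrite pnatr_eq0 -lt0n.
have sin_gt0 : 0 < sin (theta n (k %% n) / 2).
  apply: sin_gt0_pi.
  have -> : theta n (k %% n) / 2 = pi * ((k %% n)%:R / n%:R) :> R.
    by rewrite /theta -mulr_natr; field; rewrite pnatr_eq0 -lt0n.
  rewrite mulr_gt0 ?pi_gt0 ?divr_gt0 ?ltr0n//= gtr_pMr ?pi_gt0//.
  by rewrite ltr_pdivrMr ?ltr0n// mul1r ltr_nat ltn_mod.
by rewrite cos_half_angle lt_eqF//; have := exprn_gt0 2 sin_gt0; lra.
Qed.

(* Shifting the summation index by one multiplies the sum by [cos (theta n k)]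
   after averaging over the two directions. *)
Lemma sum_cos_theta0 n k phi : ~~ (n %| k)%N ->
  \sum_(j < n) cos (theta n k * j%:R + phi) = 0.
Proof.
case: n => [|n] nk; first by rewrite big_ord0.
pose S psi := \sum_(j < n.+1) cos (theta n.+1 k * j%:R + psi).
have shift psi : S (psi + theta n.+1 k) = S psi.
  rewrite /S -(sum_shift_periodic 1 (fun j => cos_thetaD n.+1 k j psi)).
  by apply: eq_bigr => j _; rewrite natrD; congr cos; ring.
have average : S (phi + theta n.+1 k) + S (phi - theta n.+1 k) =
    2 * cos (theta n.+1 k) * S phi.
  rewrite mulr_sumr -big_split/=; apply: eq_bigr => j _.
  by rewrite !addrA cosD cosB; ring.
move: average; rewrite shift -(shift (phi - _)) subrK -/(S phi) => average.
have /eqP : (1 - cos (theta n.+1 k)) * S phi = 0 by lra.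
by rewrite mulf_eq0 subr_eq0 eq_sym (negbTE (cos_theta_neq1 _ nk))// => /eqP.
Qed.

Lemma sum_sin_theta0 n k : ~~ (n %| k)%N ->
  \sum_(j < n) sin (theta n k * j%:R) = 0.
Proof. by move=> nk; under eq_bigr do rewrite -cosBpihalf; exact: sum_cos_theta0. Qed.

End periodic_sums.

Section trigonometric_forms.
Context {R : realType}.
Implicit Types (a b : R) (n k j m : nat).

Definition trig_form n k a b j : R :=
  a * cos (theta n k * j%:R) + b * sin (theta n k * j%:R).

Lemma trig_form_sqr_le n k a b j : trig_form n k a b j ^+ 2 <= a ^+ 2 + b ^+ 2.
Proof.
rewrite -subr_ge0 -[a ^+ 2 + b ^+ 2]mulr1 -(cos2Dsin2 (theta n k * j%:R)).
rewrite /trig_form; set c := cos _; set s := sin _.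
have -> : (a ^+ 2 + b ^+ 2) * (c ^+ 2 + s ^+ 2) - (a * c + b * s) ^+ 2 =
  (a * s - b * c) ^+ 2 by ring.
exact: sqr_ge0.
Qed.

Lemma trig_form_period n k a b j : trig_form n k a b (j + n) = trig_form n k a b j.
Proof.
have := sin_thetaD n k j (0 : R); have := cos_thetaD n k j (0 : R).
by rewrite /trig_form !addr0 => -> ->.
Qed.

Lemma trig_form_scale n k a b j y :
  trig_form n k a b j * y = trig_form n k (a * y) (b * y) j.
Proof. by rewrite /trig_form; ring. Qed.

Lemma sum_trig_form_sqr n k a b : ~~ (n %| k.*2)%N ->
  \sum_(j < n) trig_form n k a b j ^+ 2 = n%:R * (a ^+ 2 + b ^+ 2) / 2.
Proof.
move=> nk.
transitivity (\sum_(j < n) ((a ^+ 2 + b ^+ 2) / 2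
   + (a ^+ 2 - b ^+ 2) / 2 * cos (theta n k.*2 * j%:R + 0)
   + a * b * sin (theta n k.*2 * j%:R))).
  apply: eq_bigr => j _; rewrite addr0 theta_double cos_mulr2n sin_mulr2n.
  rewrite /trig_form sqrrD exprMn [(b * sin _) ^+ 2]exprMn sin2cos2.
  by move: (cos _) (sin _) => c s; field.
rewrite !big_split/= -!mulr_sumr sum_cos_theta0// sum_sin_theta0//.
by rewrite !mulr0 !addr0 sumr_const card_ord -mulr_natl; field.
Qed.

Lemma sum_one_minus_cos_small n k a b : ~~ (n %| k.*2)%N ->
  a ^+ 2 + b ^+ 2 <= 1 ->
  n%:R * (a ^+ 2 + b ^+ 2) / 8 <= \sum_(j < n) (1 - cos (trig_form n k a b j)).
Proof.
move=> nk ab_le1.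
have -> : n%:R * (a ^+ 2 + b ^+ 2) / 8 = \sum_(j < n) trig_form n k a b j ^+ 2 / 4.
  by rewrite -mulr_suml sum_trig_form_sqr//; field.
apply: ler_sum => j _; apply: one_minus_cos_ge.
exact: le_trans (trig_form_sqr_le _ _ _ _ _) ab_le1.
Qed.

Lemma trig_form_translate n k a b m : exists a' b', [/\
  forall j, trig_form n k a' b' j = trig_form n k a b j - trig_form n k a b (j + m)
  & a' ^+ 2 + b' ^+ 2 = (a ^+ 2 + b ^+ 2) * (2 * (1 - cos (theta n k * m%:R)))].
Proof.
set eta := theta n k * m%:R.
exists (a - (a * cos eta + b * sin eta)), (b - (b * cos eta - a * sin eta)).
split=> [j|]; first by rewrite /trig_form natrD mulrDr -/eta cosD sinD; ring.
transitivity ((a ^+ 2 + b ^+ 2) * (1 - 2 * cos eta + (cos eta ^+ 2 + sin eta ^+ 2))).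
  by ring.
by rewrite cos2Dsin2; ring.
Qed.

Lemma cos_theta_gcd n k l : (0 < n)%N -> (0 < k)%N ->
  exists m, cos (theta n k * m%:R) = cos (theta n (gcdn k n) * l%:R) :> R.
Proof.
move=> n_gt0 k_gt0; case: (egcdnP n k_gt0) => u v bezout _; exists (u * l)%N.
have bezoutR : u%:R * k%:R = v%:R * n%:R + (gcdn k n)%:R :> R.
  by rewrite -!natrM bezout natrD natrM.
rewrite -[RHS](periodicn (@cosD2pi R) (v * l)); congr cos.
transitivity (pi *+ 2 * (u%:R * k%:R) / n%:R * l%:R : R).
  by rewrite /theta natrM; ring.
by rewrite bezoutR /theta -[_ *+ (v * l)]mulr_natr natrM; field; rewrite pnatr_eq0 -lt0n.
Qed.

(* The multiples of the angle [theta n (gcdn k n) <= 1 / norm (a, b)] contain one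
   close to [1 / norm (a, b)]. *)
Lemma exists_translate n k (rho2 : R) : (0 < n)%N -> (0 < k)%N -> 1 <= rho2 ->
  64 * rho2 * (gcdn k n)%:R ^+ 2 <= n%:R ^+ 2 ->
  exists m, 1 / 8 <= rho2 * (2 * (1 - cos (theta n k * m%:R))) <= 1.
Proof.
move=> n_gt0 k_gt0 rho2_ge1; set g := gcdn k n => small_gcd.
have rho2_ge0 : 0 <= rho2 by lra.
have nR : 0 < n%:R :> R by rewrite ltr0n.
have gR : 0 < g%:R :> R by rewrite ltr0n gcdn_gt0 k_gt0.
pose r := Num.sqrt rho2; have r2E : r ^+ 2 = rho2 by rewrite sqr_sqrtr.
have r_ge1 : 1 <= r by rewrite -sqrtr1 ler_sqrt.
have r_gt0 : 0 < r by lra.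
have rg_gt0 : 0 < r * g%:R by rewrite mulr_gt0.
have rg_le : 8 * (r * g%:R) <= n%:R.
  rewrite -ler_sqr ?nnegrE ?(ltW nR)//; last by rewrite mulr_ge0// ltW.
  apply: le_trans small_gcd; rewrite -r2E.
  by apply: eq_ler; ring.
have step_gt0 : 0 < r * theta n g.
  by rewrite mulr_gt0// /theta divr_gt0// mulr_gt0// mulrn_wgt0// pi_gt0.
have step_le1 : r * theta n g <= 1.
  rewrite /theta mulrA ler_pdivrMr// mul1r -mulr_natr.
  by have := @pihalf_lt2 R; have := @pi_gt0 R; nra.
have [|l l_gt0 /andP[l_ge l_le]] := @exists_nat_half_le _ (r * theta n g)^-1.
  by rewrite invf_ge1.
have [m cosE] := cos_theta_gcd l n_gt0 k_gt0; exists m; rewrite cosE -/g.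
set eta := theta n g * l%:R.
have reta_ge : 1 / 2 <= r * eta.
  by rewrite /eta mulrA -ler_pdivrMl// div1r.
have reta_le : r * eta <= 1 by rewrite /eta mulrA -ler_pdivlMl// mulr1.
have eta_ge0 : 0 <= eta by nra.
have := one_minus_cos_le eta; have /one_minus_cos_ge : eta ^+ 2 <= 1 by nra.
rewrite -r2E => cos_ge cos_le; apply/andP; split.
  have : (r * eta) ^+ 2 / 2 <= r ^+ 2 * (2 * (1 - cos eta)).
    by rewrite exprMn -mulrA ler_wpM2l ?sqr_ge0//; lra.
  nra.
have : r ^+ 2 * (2 * (1 - cos eta)) <= (r * eta) ^+ 2.
  by rewrite exprMn ler_wpM2l ?sqr_ge0//; lra.
nra.
Qed.

(* When the coefficients are large, the form is compared with its difference with
   a translate, whose coefficient vector has norm between [1 / sqrt 8] and [1]. *)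
Lemma sum_one_minus_cos_large n k a b : (0 < n)%N -> ~~ (n %| k.*2)%N ->
  1 <= a ^+ 2 + b ^+ 2 ->
  64 * (a ^+ 2 + b ^+ 2) * (gcdn k n)%:R ^+ 2 <= n%:R ^+ 2 ->
  n%:R / 256 <= \sum_(j < n) (1 - cos (trig_form n k a b j)).
Proof.
move=> n_gt0 nk ab_ge1 small_gcd.
have k_gt0 : (0 < k)%N by case: k nk {small_gcd} => //; rewrite dvdn0.
have [m /andP[norm_ge norm_le]] := exists_translate n_gt0 k_gt0 ab_ge1 small_gcd.
have [a' [b' [translate norm']]] := trig_form_translate n k a b m.
rewrite -norm' in norm_ge norm_le.
have doubling : \sum_(j < n) (1 - cos (trig_form n k a' b' j)) <=
    4 * \sum_(j < n) (1 - cos (trig_form n k a b j)).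
  have -> : 4 * \sum_(j < n) (1 - cos (trig_form n k a b j)) =
      \sum_(j < n) (2 * (1 - cos (trig_form n k a b j)) +
                    2 * (1 - cos (trig_form n k a b (j + m)))).
    rewrite [RHS]big_split/= -!mulr_sumr.
    rewrite (@sum_shift_periodic _ n (fun j => 1 - cos (trig_form n k a b j))).
      by rewrite -mulrDl; congr (_ * _); rewrite -natrD.
    by move=> j; rewrite trig_form_period.
  by apply: ler_sum => j _; rewrite translate one_minus_cosB.
have := sum_one_minus_cos_small nk norm_le.
have : n%:R * (1 / 8) <= n%:R * (a' ^+ 2 + b' ^+ 2) by rewrite ler_wpM2l.
lra.
Qed.

Lemma sum_one_minus_cos_ge n k a b : (0 < n)%N -> ~~ (n %| k.*2)%N ->
  a ^+ 2 + b ^+ 2 <= 1 \/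
  64 * (a ^+ 2 + b ^+ 2) * (gcdn k n)%:R ^+ 2 <= n%:R ^+ 2 ->
  n%:R / 256 * Num.min 1 (a ^+ 2 + b ^+ 2) <=
  \sum_(j < n) (1 - cos (trig_form n k a b j)).
Proof.
move=> n_gt0 nk; have [ab_le1 _|ab_gt1 [//|small_gcd]] := leP (a ^+ 2 + b ^+ 2) 1.
- apply: le_trans (sum_one_minus_cos_small nk ab_le1).
  by have := ler0n R n; have := sqr_ge0 a; have := sqr_ge0 b; nra.
- by rewrite mulr1; apply: sum_one_minus_cos_large (ltW ab_gt1) small_gcd.
Qed.

(* A frequency [k] with [n %| k.*2] belongs to a real eigenvalue. *)
Lemma sin_theta_real n k j : (n %| k.*2)%N -> sin (theta n k * j%:R) = 0 :> R.
Proof.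
case: n => [|n] /dvdnP[c kE]; first by rewrite /theta invr0 mulr0 mul0r sin0.
have half : k%:R = c%:R * n.+1%:R / 2 :> R by rewrite -natrM -kE -muln2 natrM mulfK.
have -> : theta n.+1 k * j%:R = 0 + pi *+ (c * j) :> R.
  by rewrite /theta half -[_ *+ (c * j)]mulr_natr natrM; field; rewrite gt_eqF.
by rewrite (alternatingn (@sinDpi R)) sin0 mulr0.
Qed.

Lemma sum_one_minus_cos_real n k a : (n %| k.*2)%N -> a ^+ 2 <= 1 ->
  n%:R * a ^+ 2 / 4 <= \sum_(j < n) (1 - cos (trig_form n k a 0 j)).
Proof.
move=> nk a_le1.
have trig_form_sqr j : trig_form n k a 0 j ^+ 2 = a ^+ 2.
  by rewrite /trig_form mul0r addr0 exprMn cos2sin2 sin_theta_real// expr0n subr0 mulr1.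
have -> : n%:R * a ^+ 2 / 4 = \sum_(j < n) trig_form n k a 0 j ^+ 2 / 4.
  by under eq_bigr do rewrite trig_form_sqr; rewrite sumr_const card_ord -[RHS]mulr_natl mulrA.
by apply: ler_sum => j _; apply: one_minus_cos_ge; rewrite trig_form_sqr.
Qed.

End trigonometric_forms.

Lemma card_small_order n Q : (0 < n)%N ->
  (#|[pred k : 'I_n | (n <= Q * gcdn k n)%N]| <= Q.+1 ^ 2)%N.
Proof.
move=> n_gt0; set A := [pred k | _].
have gcd_gt0 (k : 'I_n) : (0 < gcdn k n)%N by rewrite gcdn_gt0 n_gt0 orbT.
have quotient_small (k : 'I_n) : k \in A ->
    (n %/ gcdn k n < Q.+1)%N /\ (k %/ gcdn k n < Q.+1)%N.
  rewrite inE => kA; have nQ : (n %/ gcdn k n <= Q)%N.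
    by rewrite -(mulnK Q (gcd_gt0 k)) leq_div2r.
  by split; rewrite ltnS//; apply: leq_trans nQ; rewrite leq_div2r// ltnW.
pose reduced (k : 'I_n) : 'I_Q.+1 * 'I_Q.+1 :=
  (inord (n %/ gcdn k n), inord (k %/ gcdn k n)).
have reduced_inj : {in A &, injective reduced}.
  move=> k l /quotient_small[k1 k2] /quotient_small[l1 l2] [].
  move=> /(congr1 val); rewrite /= !inordK// => denomE.
  move=> /(congr1 val); rewrite /= !inordK// => numE.
  have gcdE : gcdn k n = gcdn l n.
    have d_gt0 : (0 < n %/ gcdn l n)%N by rewrite divn_gt0// dvdn_leq// dvdn_gcdr.
    by apply/eqP; rewrite -(eqn_pmul2l d_gt0) -{1}denomE !divnK ?dvdn_gcdr.
  by apply: val_inj; rewrite /= -(divnK (dvdn_gcdl k n)) numE gcdE divnK// dvdn_gcdl.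
rewrite -(card_in_imset reduced_inj) (leq_trans (max_card _))//.
by rewrite card_prod card_ord.
Qed.

Section circulant_spectrum.
Context {R : realType}.
Implicit Types (x : nat -> R) (n k : nat) (phi : R).

Definition dft_re n k x : R := \sum_(j < n) x j * cos (theta n k * j%:R).
Definition dft_im n k x : R := \sum_(j < n) x j * sin (theta n k * j%:R).
Definition dft_sqr n k x : R := dft_re n k x ^+ 2 + dft_im n k x ^+ 2.

Lemma sum_trig_form n k a b x :
  \sum_(j < n) trig_form n k a b j * x j = a * dft_re n k x + b * dft_im n k x.
Proof.
rewrite /dft_re /dft_im !mulr_sumr -big_split/=.
by apply: eq_bigr => j _; rewrite /trig_form; ring.
Qed.

Lemma sum_circulant_row n k x phi (i : 'I_n) :
  \sum_(j < n) circulant n x i j * cos (theta n k * j%:R + phi) =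
  \sum_(m < n) x m * cos (theta n k * m%:R + (theta n k * i%:R + phi)).
Proof.
have i_le := ltnW (ltn_ord i).
pose F l := x (l %% n)%N * cos (theta n k * l%:R + (theta n k * i%:R + phi)).
transitivity (\sum_(j < n) F (j + (n - i))%N).
  apply: eq_bigr => j _; rewrite mxE /F addnBA//; congr (_ * _).
  by rewrite -cos_thetaD addrA -mulrDr -natrD subnK// (leq_trans i_le) ?leq_addl.
rewrite sum_shift_periodic => [|l]; last by rewrite /F modnDr cos_thetaD.
by apply: eq_bigr => m _; rewrite /F modn_small.
Qed.

Lemma sum_circulant_col n k x phi (i : 'I_n) :
  \sum_(j < n) circulant n x j i * cos (theta n k * j%:R + phi) =
  \sum_(m < n) x m * cos (theta n k * m%:R - (theta n k * i%:R + phi)).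
Proof.
pose F l := x (l %% n)%N * cos (theta n k * l%:R - (theta n k * i%:R + phi)).
rewrite (reindex_inj rev_ord_inj)/=.
transitivity (\sum_(j < n) F (j + i.+1)%N).
  apply: eq_bigr => j _; have j_lt := ltn_ord j; have i_lt := ltn_ord i.
  rewrite mxE /F; congr (x (_ %% _)%N * _); first by rewrite /=; lia.
  have period (y : R) : cos (y + theta n k * n%:R) = cos y.
    by have := cos_thetaD n k 0 y; rewrite add0n mulr0 add0r addrC.
  by rewrite -cosN -period natrB// natrD -(natr1 i) -(natr1 j); congr cos; ring.
rewrite sum_shift_periodic => [|l]; last by rewrite /F modnDr cos_thetaD.
by apply: eq_bigr => m _; rewrite /F modn_small.
Qed.

Definition wave n k phi : 'cV[R]_n := \col_i cos (theta n k * i%:R + phi).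

Lemma wave_half_turn n k phi : wave n k (phi - pi / 2 - pi / 2) = - wave n k phi.
Proof. by apply/colP => i; rewrite !mxE !addrA cosBpihalf sinBpihalf. Qed.

Lemma circulant_wave n k phi x : circulant n x *m wave n k phi =
  dft_re n k x *: wave n k phi - dft_im n k x *: wave n k (phi - pi / 2).
Proof.
apply/colP => i; rewrite mxE.
under eq_bigr do rewrite [wave _ _ _ _ _]mxE; rewrite sum_circulant_row.
rewrite !mxE addrA cosBpihalf /dft_re /dft_im !mulr_suml -sumrB.
by apply: eq_bigr => m _; rewrite cosD; ring.
Qed.

Lemma tr_circulant_wave n k phi x : (circulant n x)^T *m wave n k phi =
  dft_re n k x *: wave n k phi + dft_im n k x *: wave n k (phi - pi / 2).
Proof.
apply/colP => i; rewrite mxE.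
under eq_bigr do rewrite mxE [wave _ _ _ _ _]mxE; rewrite sum_circulant_col.
rewrite !mxE addrA cosBpihalf /dft_re /dft_im !mulr_suml -big_split.
by apply: eq_bigr => m _; rewrite /= cosB; ring.
Qed.

Lemma gram_circulant_wave n k phi x :
  (circulant n x)^T *m circulant n x *m wave n k phi = dft_sqr n k x *: wave n k phi.
Proof.
rewrite -mulmxA circulant_wave mulmxBr -!scalemxAr !tr_circulant_wave.
by rewrite wave_half_turn; apply/colP => i; rewrite !mxE /dft_sqr; ring.
Qed.

Lemma wave_separating n (v : 'rV[R]_n) :
  (forall (k : 'I_n) phi, v *m wave n k phi = 0) -> v = 0.
Proof.
move=> v_wave; apply/rowP => i; rewrite mxE.
have n_gt0 : (0 < n)%N by case: (n) i {v v_wave} => // -[].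
have : \sum_(k < n) \sum_(j < n) v 0 j * cos (theta n k * j%:R - theta n k * i%:R) = 0.
  apply: big1 => k _; have /rowP/(_ 0) := v_wave k (- (theta n k * i%:R)).
  by rewrite !mxE => vE; rewrite -[RHS]vE; apply: eq_bigr => j _; rewrite mxE.
have orthogonal (j : 'I_n) : j != i ->
    \sum_(k < n) cos (theta n k * j%:R - theta n k * i%:R) = 0.
  wlog lt_ij : i j {v_wave} / (i < j)%N => [sorted ji|_].
    have [/sorted|/sorted|/val_inj ij] := ltngtP i j; first exact.
      by under eq_bigr do rewrite -cosN opprB; apply; rewrite eq_sym.
    by rewrite ij eqxx in ji.
  have ndvd : ~~ (n %| j - i)%N.
    by rewrite gtnNdvd ?subn_gt0// (leq_ltn_trans (leq_subr _ _)).
  rewrite -[RHS](sum_cos_theta0 0 ndvd); apply: eq_bigr => k _.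
  by rewrite -mulrBr -natrB 1?ltnW// theta_swap addr0.
rewrite exchange_big/= (bigD1 i)//= [X in _ + X]big1 => [|j ji].
  rewrite addr0; under eq_bigr do rewrite subrr cos0 mulr1.
  rewrite sumr_const card_ord => /eqP; rewrite mulrn_eq0 -leqn0 leqNgt n_gt0/=.
  by move/eqP.
by rewrite -mulr_sumr orthogonal// mulr0.
Qed.

Lemma eigenvalue_gram_circulant n x (l : R) : (0 < n)%N ->
  eigenvalue ((circulant n x)^T *m circulant n x) l <->
  exists k : 'I_n, l = dft_sqr n k x.
Proof.
move=> n_gt0; split=> [/eigenvalueP[v vA v_neq0]|[k ->]].
  apply: contrapT => not_dft; move/eqP : v_neq0; apply.
  apply: wave_separating => k phi.
  have /(congr1 (mulmx v)) := gram_circulant_wave n k phi x.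
  rewrite mulmxA vA -scalemxAl -scalemxAr => /eqP.
  rewrite -subr_eq0 -scalerBl scalemx_eq0 subr_eq0 => /orP[/eqP lE|/eqP//].
  by exfalso; apply: not_dft; exists k.
apply/eigenvalueP; exists (wave n k 0)^T.
  have sym : ((circulant n x)^T *m circulant n x)^T =
    (circulant n x)^T *m circulant n x by rewrite trmx_mul trmxK.
  by rewrite -{1}sym -trmx_mul gram_circulant_wave linearZ.
apply/eqP => /rowP/(_ (Ordinal n_gt0)); rewrite !mxE mulr0 addr0 cos0 => /eqP.
by rewrite oner_eq0.
Qed.

Lemma kappa_circulant_le n x (c : R) : (0 < n)%N -> 0 <= c ->
  (kappa (circulant n x) <= c%:E)%E <->
  (forall k : 'I_n, 0 < dft_sqr n k x) /\
  (forall k l : 'I_n, Num.sqrt (dft_sqr n k x) <= c * Num.sqrt (dft_sqr n l x)).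
Proof.
move=> n_gt0 c_ge0; rewrite /kappa /sigma_max /sigma_min.
pose lam (k : 'I_n) := dft_sqr n k x.
have -> : [set l | eigenvalue ((circulant n x)^T *m circulant n x) l] = range lam.
  apply/seteqP; split=> l /=.
    by move=> /eigenvalue_gram_circulant -/(_ n_gt0)[k ->]; exists k.
  by move=> [k _ <-]; apply/eigenvalue_gram_circulant => //; exists k.
have [kM _ lam_le] := @Order.TotalTheory.arg_maxP _ _ _ (Ordinal n_gt0) xpredT lam isT.
have [km _ le_lam] := @Order.TotalTheory.arg_minP _ _ _ (Ordinal n_gt0) xpredT lam isT.
have lam_neq0 : range lam !=set0 by exists (lam kM), kM.
have -> : sup (range lam) = lam kM.
  apply/eqP; rewrite eq_le ge_sup//=; last by move=> _ [k _ <-]; exact: lam_le.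
  by apply: ub_le_sup; [exists (lam kM) => _ [k _ <-]; exact: lam_le | exists kM].
have -> : inf (range lam) = lam km.
  apply/eqP; rewrite eq_le lb_le_inf ?andbT//; last by move=> _ [k _ <-]; exact: le_lam.
  by apply: ge_inf; [exists (lam km) => _ [k _ <-]; exact: le_lam | exists km].
have [sqrt0|sqrt_neq0] := eqVneq (Num.sqrt (lam km)) 0.
  split=> [|[/(_ km) + _]]; first by rewrite leye_eq.
  by rewrite -sqrtr_gt0 sqrt0 ltxx.
have sqrt_gt0 : 0 < Num.sqrt (lam km) by rewrite lt0r sqrt_neq0 sqrtr_ge0.
rewrite lee_fin ler_pdivrMr//; split=> [max_le|[_]]; last exact.
split=> [k|k l]; first by rewrite (lt_le_trans _ (le_lam k isT))// -sqrtr_gt0.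
apply: (@le_trans _ _ (Num.sqrt (lam kM))); first exact/ler_wsqrtr/lam_le.
by rewrite (le_trans max_le)// ler_wpM2l//; exact/ler_wsqrtr/le_lam.
Qed.

Lemma kappa_circulant_le_bounds n x (t a c : R) : (0 < n)%N -> 0 < t -> 2 * a <= c * t ->
  (forall k : 'I_n, t < `|dft_re n k x| \/ t < `|dft_im n k x|) ->
  (forall k : 'I_n, `|dft_re n k x| <= a /\ `|dft_im n k x| <= a) ->
  (kappa (circulant n x) <= c%:E)%E.
Proof.
move=> n_gt0 t_gt0 a_le dft_gt dft_le.
have a_ge0 : 0 <= a by have [+ _] := dft_le (Ordinal n_gt0); apply: le_trans.
have c_ge0 : 0 <= c by rewrite -(pmulr_lge0 _ t_gt0); lra.
have sqr_gt (k : 'I_n) : t ^+ 2 < dft_sqr n k x.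
  have lt_sqr (y : R) : t < `|y| -> t ^+ 2 < y ^+ 2.
    by rewrite -[y ^+ 2]real_normK ?num_real// ltr_sqr// nnegrE ltW.
  rewrite /dft_sqr; case: (dft_gt k) => /lt_sqr.
    by have := sqr_ge0 (dft_im n k x); lra.
  by have := sqr_ge0 (dft_re n k x); lra.
have sqr_le (k : 'I_n) : dft_sqr n k x <= (2 * a) ^+ 2.
  have le_sqr (y : R) : `|y| <= a -> y ^+ 2 <= a ^+ 2.
    by rewrite -[y ^+ 2]real_normK ?num_real// ler_sqr.
  rewrite /dft_sqr exprMn; have [/le_sqr + /le_sqr] := dft_le k.
  by have := sqr_ge0 a; lra.
apply/kappa_circulant_le => //; split=> [k|k l].
  by apply: lt_trans (sqr_gt k); rewrite exprn_gt0.
have sqrt_sqr (y : R) : 0 <= y -> Num.sqrt (y ^+ 2) = y by move=> ?; rewrite sqrtr_sqr ger0_norm.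
apply: (@le_trans _ _ (2 * a)).
  by rewrite -(sqrt_sqr (2 * a)) ?mulr_ge0// ler_wsqrtr.
apply: le_trans a_le _; apply: ler_wpM2l => //.
by rewrite -(sqrt_sqr t (ltW t_gt0)) ler_wsqrtr// ltW.
Qed.

End circulant_spectrum.

Section measurability.
Context {R : realType} {d : measure_display} {T : measurableType d}.
Implicit Types f g : T -> R.

Lemma measurable_setle f g : measurable_fun setT f -> measurable_fun setT g ->
  measurable [set w | f w <= g w].
Proof. by move=> mf mg; rewrite -[X in measurable X]setTI; exact: measurable_fun_le. Qed.

Lemma measurable_setlt f g : measurable_fun setT f -> measurable_fun setT g ->
  measurable [set w | f w < g w].
Proof.
move=> mf mg; rewrite (_ : [set w | _] = ~` [set w | g w <= f w]).
  by apply: measurableC; exact: measurable_setle.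
by apply/seteqP; split=> w /=; rewrite ltNge => /negP.
Qed.

Lemma measurable_set_between f a b : measurable_fun setT f ->
  measurable [set w | a <= f w <= b].
Proof.
move=> mf; rewrite (_ : [set w | _] = [set w | a <= f w] `&` [set w | f w <= b]).
  by apply: measurableI; exact: measurable_setle.
by apply/seteqP; split=> w /=; [move=> /andP[]|move=> [le_f f_le]; apply/andP].
Qed.

Lemma measurable_cos : measurable_fun setT (@cos R).
Proof. by apply: continuous_measurable_fun; exact: continuous_cos. Qed.

Lemma measurable_sin : measurable_fun setT (@sin R).
Proof. by apply: continuous_measurable_fun; exact: continuous_sin. Qed.

Lemma measurable_exists_ord n (A : nat -> set T) : (forall k, measurable (A k)) ->
  measurable [set w | exists k : 'I_n, A k w].
Proof.
move=> mA; rewrite (_ : [set w | _] = \bigcup_(k in [set: 'I_n]) A k).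
  exact: fin_bigcup_measurable.
by apply/seteqP; split=> w [k]; [exists k|move=> _; exists k].
Qed.

End measurability.

Section expectations.
Context {R : realType} {d : measure_display} {T : measurableType d}.
Variable P : probability T R.
Implicit Types X Y : T -> R.

Lemma probability_exists_ord_le n (A : nat -> set T) : (forall k, measurable (A k)) ->
  (P [set w | exists k : 'I_n, A k w] <= \sum_(k < n) P (A k))%E.
Proof.
move=> mA; rewrite (_ : [set w | _] = \big[setU/set0]_(k < n) A k); last first.
  rewrite -bigcup_mkord; apply/seteqP; split=> w [k]; first by exists (val k) => /=.
  by move=> /= k_lt Akw; exists (Ordinal k_lt).
exact: Boole_inequality.
Qed.

Lemma Rintegral_probability_cst c : \int[P]_w c = c.
Proof. by rewrite Rintegral_cst// [X in fine X](probability_setT P) mulr1. Qed.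

Lemma Rintegral_indic A : measurable A -> \int[P]_w \1_A w = fine (P A).
Proof. by move=> mA; rewrite /Rintegral integral_indic// setIT. Qed.

Lemma integrable_sumr (I : Type) (s : seq I) (F : I -> T -> R) :
  (forall i, P.-integrable setT (EFin \o F i)) ->
  P.-integrable setT (EFin \o (fun w => \sum_(i <- s) F i w)).
Proof.
move=> iF; rewrite (_ : EFin \o _ = fun w => \sum_(i <- s) (F i w)%:E)%E.
  by apply: integrable_sum => // i _; exact: iF.
by apply/funext => w; rewrite /= -sumEFin.
Qed.

Lemma Rintegral_sum (I : Type) (s : seq I) (F : I -> T -> R) :
  (forall i, P.-integrable setT (EFin \o F i)) ->
  \int[P]_w (\sum_(i <- s) F i w) = \sum_(i <- s) \int[P]_w F i w.
Proof.
move=> iF; elim: s => [|i s ih].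
  by rewrite big_nil; under eq_Rintegral do rewrite big_nil; rewrite Rintegral_probability_cst.
rewrite big_cons -ih -RintegralD//; last exact: integrable_sumr.
by apply: eq_Rintegral => w _; rewrite big_cons.
Qed.

Lemma integrable_le1 X : measurable_fun setT X -> (forall w, `|X w| <= 1) ->
  P.-integrable setT (EFin \o X).
Proof.
move=> mX X_le1; apply: measurable_bounded_integrable => //.
  exact: le_lt_trans (probability_le1 P measurableT) (ltry _).
by exists 1; split=> // c /ltW c_ge1 w _ /=; exact: le_trans (X_le1 w) c_ge1.
Qed.

Lemma integrable_cos X : measurable_fun setT X ->
  P.-integrable setT (EFin \o (fun w => cos (X w))).
Proof.
move=> mX; apply: integrable_le1 => [|w]; last exact: cos_max.
exact: measurableT_comp measurable_cos mX.
Qed.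

End expectations.

Section independence.
Context {R : realType} {d d1 d2 : measure_display} {T : measurableType d}.
Context {T1 : measurableType d1} {T2 : measurableType d2} (P : probability T R).

Definition indep_rv (X : T -> T1) (Y : T -> T2) :=
  forall A B, measurable A -> measurable B ->
  (P (X @^-1` A `&` Y @^-1` B) = P (X @^-1` A) * P (Y @^-1` B))%E.

Lemma indep_rv_joint_law (X : {RV P >-> T1}) (Y : {RV P >-> T2})
    (XY : {RV P >-> (T1 * T2)%type}) :
  (forall w, XY w = (X w, Y w)) -> indep_rv X Y ->
  forall C, measurable C -> distribution P XY C = (distribution P X \x distribution P Y)%E C.
Proof.
move=> XYE indep C mC; apply/esym; apply: product_measure_unique mC => A B mA mB.
rewrite -indep// /distribution /pushforward; congr (P _).
by apply/seteqP; split=> w; rewrite /= XYE.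
Qed.

End independence.

Lemma indep_rv_comp {R : realType} {d d1 d2 d3 d4 : measure_display}
    {T : measurableType d} {T1 : measurableType d1} {T2 : measurableType d2}
    {T3 : measurableType d3} {T4 : measurableType d4} (P : probability T R)
    (X : T -> T1) (Y : T -> T2) (f : T1 -> T3) (g : T2 -> T4) :
  measurable_fun setT f -> measurable_fun setT g ->
  indep_rv P X Y -> indep_rv P (f \o X) (g \o Y).
Proof.
move=> mf mg indep A B mA mB; apply: (indep (f @^-1` A) (g @^-1` B)).
  by rewrite -[X in measurable X]setTI; exact: mf.
by rewrite -[X in measurable X]setTI; exact: mg.
Qed.

Section independent_products.
Context {R : realType} {d : measure_display} {T : measurableType d}.
Variables (P : probability T R) (X Y : T -> R).
Hypotheses (mX : measurable_fun setT X) (mY : measurable_fun setT Y).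
Hypothesis indep : indep_rv P X Y.

Let X' : {RV P >-> R} := mfun_Sub (mem_set mX).
Let Y' : {RV P >-> R} := mfun_Sub (mem_set mY).
Let XY : {RV P >-> (R * R)%type} := mfun_Sub (mem_set (measurable_fun_pair mX mY)).

Let joint_law C : measurable C ->
  distribution P XY C = (distribution P X' \x distribution P Y')%E C.
Proof. exact: (@indep_rv_joint_law _ _ _ _ _ _ _ P X' Y' XY). Qed.

Let measurable_mul : measurable_fun setT (fun z : R * R => z.1 * z.2).
Proof. exact: measurable_funM. Qed.

Lemma integral_norm_indepM :
  (\int[P]_w `|X w * Y w|%:E = \int[P]_w `|X w|%:E * \int[P]_w `|Y w|%:E)%E.
Proof.
have mnorm : measurable_fun setT (fun x : R => `|x|%:E) by exact/measurable_EFinP.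
have mnormM : measurable_fun setT (fun z : R * R => `|z.1 * z.2|%:E).
  by apply/measurable_EFinP; exact: measurableT_comp measurable_mul.
rewrite -[LHS](@ge0_integral_distribution _ _ _ _ _ P XY (fun z => `|z.1 * z.2|%:E))//.
rewrite -[X in (X * _)%E](@ge0_integral_distribution _ _ _ _ _ P X' (fun x => `|x|%:E))//.
rewrite -[X in (_ * X)%E](@ge0_integral_distribution _ _ _ _ _ P Y' (fun x => `|x|%:E))//.
rewrite (eq_measure_integral (distribution P X' \x distribution P Y')%E) => [|C mC _];
  last exact: joint_law.
rewrite fubini_tonelli1//= -ge0_integralZr//; last exact: integral_ge0.
apply: eq_integral => x _; rewrite /fubini_F/= -ge0_integralZl//.
by apply: eq_integral => y _; rewrite normrM EFinM.
Qed.

Lemma ge0_integral_indepM : (forall w, 0 <= X w) -> (forall w, 0 <= Y w) ->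
  (\int[P]_w (X w * Y w)%:E = \int[P]_w (X w)%:E * \int[P]_w (Y w)%:E)%E.
Proof.
move=> X_ge0 Y_ge0; have := integral_norm_indepM.
under eq_integral do rewrite ger0_norm ?mulr_ge0//.
under [X in _ = (X * _)%E -> _]eq_integral do rewrite ger0_norm//.
by under [X in _ = (_ * X)%E -> _]eq_integral do rewrite ger0_norm//.
Qed.

Lemma Rintegral_indepM :
  P.-integrable setT (EFin \o X) -> P.-integrable setT (EFin \o Y) ->
  \int[P]_w (X w * Y w) = \int[P]_w X w * \int[P]_w Y w.
Proof.
move=> iX iY.
have norm_lty Z : P.-integrable setT (EFin \o Z) -> (\int[P]_w `|Z w|%:E < +oo)%E.
  by move=> /integrableP[].
have iXY : P.-integrable setT (EFin \o (fun w => X w * Y w)).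
  apply/integrableP; split; first by apply/measurable_EFinP; exact: measurable_funM.
  rewrite [ltLHS]integral_norm_indepM lte_mul_pinfty ?norm_lty ?integral_ge0//.
  by rewrite ge0_fin_numE ?norm_lty ?integral_ge0.
have integrable_law (Z : {RV P >-> R}) : P.-integrable setT (EFin \o Z) ->
    (distribution P Z).-integrable setT EFin.
  by move=> iZ; apply: integrable_pushforward.
have integrable_prod_law : (distribution P X' \x distribution P Y')%E.-integrable setT
    (fun z : R * R => (z.1 * z.2)%:E).
  apply/integrableP; split; first exact/measurable_EFinP.
  rewrite (eq_measure_integral (distribution P XY)) => [|C mC _]; last exact/esym/joint_law.
  rewrite ge0_integral_distribution//; first by move/integrableP : iXY => [].
  by apply: measurableT_comp => //; exact/measurable_EFinP.
rewrite /Rintegral -fineM ?integrable_fin_num//; congr fine.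
rewrite -[LHS](@integral_distribution _ _ _ _ _ P XY (fun z => (z.1 * z.2)%:E))//;
  last exact/measurable_EFinP.
rewrite (eq_measure_integral (distribution P X' \x distribution P Y')%E) => [|C mC _];
  last exact: joint_law.
rewrite -[X in (X * _)%E](@integral_distribution _ _ _ _ _ P X' EFin)//.
rewrite -[X in (_ * X)%E](@integral_distribution _ _ _ _ _ P Y' EFin)//.
have Y_fin : (\int[distribution P Y']_y y%:E)%E \is a fin_num.
  by apply: integrable_fin_num => //; exact: integrable_law.
rewrite -integral12_prod_meas1// -(fineK Y_fin) -integralZr//; last exact: integrable_law.
apply: eq_integral => x _; rewrite fineK// -integralZl//; exact: integrable_law.
Qed.

End independent_products.

Section cylinders.
Context {d : measure_display} {T : measurableType d}.
Implicit Types (n : nat) (B : nat -> set T).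

Definition cylinder {n} B : set (n.-tuple T) := [set t | forall i : 'I_n, B i (tnth t i)].

Definition measurable_cylinders {n} : set_system (n.-tuple T) :=
  [set cylinder B | B in [set B | forall i, measurable (B i)]].

Lemma measurable_cylinder n B :
  (forall i, measurable (B i)) -> measurable (cylinder B : set (n.-tuple T)).
Proof.
move=> mB; rewrite (_ : cylinder B =
    \bigcap_(i in [set: 'I_n]) ((fun t : n.-tuple T => tnth t i) @^-1` B i)).
  apply: fin_bigcap_measurable => // i _.
  by rewrite -[X in measurable X]setTI; exact: measurable_tnth.
by apply/seteqP; split=> t cyl i; [move=> _; exact: cyl | exact: cyl].
Qed.

Lemma measurable_cylindersI n : setI_closed (@measurable_cylinders n).
Proof.
move=> _ _ [B mB <-] [C mC <-]; exists (fun i => B i `&` C i) => [i|].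
  exact: measurableI.
by apply/seteqP; split=> t; [move=> BC; split=> i; case: (BC i)|move=> [Bt Ct] i; split].
Qed.

Lemma sigma_measurable_cylinders n :
  @measurable _ (n.-tuple T) = <<s @measurable_cylinders n >>.
Proof.
apply/seteqP; split; last first.
  apply: smallest_sub; first exact: sigma_algebra_measurable.
  by move=> _ [B mB <-]; exact: measurable_cylinder.
apply: smallest_sub; first exact: smallest_sigma_algebra.
rewrite -bigcup_seq => A [i _ [B mB <-]]; apply: sub_sigma_algebra.
exists (fun j : nat => if j == i then B else setT) => [j|]; first by case: ifP.
rewrite setTI; apply/seteqP; split=> t /=; first by move=> /(_ i); rewrite eqxx.
by move=> Bt j; case: eqP => // /val_inj ->.
Qed.

End cylinders.

Section iid_sequences.
Context {R : realType} {d : measure_display} {T : measurableType d}.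
Variables (P : probability T R) (xi : nat -> {RV P >-> R}).
Hypothesis iid : iid_seq xi.

Lemma integral_iid k (f : R -> \bar R) : measurable_fun setT f ->
  (\int[P]_w f (xi k w) = \int[P]_w f (xi 0%N w))%E.
Proof.
have ge0_case (g : R -> \bar R) : measurable_fun setT g -> (forall x, (0 <= g x)%E) ->
    (\int[P]_w g (xi k w) = \int[P]_w g (xi 0%N w))%E.
  move=> mg g_ge0; rewrite -[LHS]ge0_integral_distribution// -[RHS]ge0_integral_distribution//.
  by apply: eq_measure_integral => A mA _; exact: iid.2.
move=> mf; rewrite -[LHS]/(integral P setT (f \o xi k)) -[RHS]/(integral P setT (f \o xi 0%N)).
rewrite integralE [RHS]integralE (funepos_comp f (xi k)) (funepos_comp f (xi 0%N)).
rewrite (funeneg_comp f (xi k)) (funeneg_comp f (xi 0%N)); congr (_ - _)%E.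
  exact: ge0_case (measurable_funepos mf) _.
exact: ge0_case (measurable_funeneg mf) _.
Qed.

Definition prefix n w : n.-tuple R := [tuple xi i w | i < n].

Lemma measurable_prefix n : measurable_fun setT (prefix n).
Proof.
apply/measurable_fun_tnthP => i; rewrite (_ : _ \o _ = xi i)//.
by apply/funext => w; rewrite /= tnth_mktuple.
Qed.

Lemma prefix_cylinder n (B : nat -> set R) :
  prefix n @^-1` cylinder B = \big[setI/setT]_(i < n) (xi i @^-1` B i).
Proof.
rewrite -(bigcap_mkord n (fun i => xi i @^-1` B i)); apply/seteqP; split=> w /=.
  by move=> cyl i /= i_lt; have := cyl (Ordinal i_lt); rewrite tnth_mktuple.
by move=> cap i; rewrite tnth_mktuple; exact: (cap i (ltn_ord i)).
Qed.

Lemma indep_prefix n : indep_rv P (prefix n) (xi n).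
Proof.
move=> A B mA mB; have mpre C : measurable C -> measurable (prefix n @^-1` C).
  by move=> mC; rewrite -[X in measurable X]setTI; exact: measurable_prefix.
have mE : measurable (xi n @^-1` B) by exact: measurable_funPTI.
set E := xi n @^-1` B in mE *.
move: A mA; rewrite sigma_measurable_cylinders; apply: dynkin_induction.
- exact: sigma_measurable_cylinders.
- exact: measurable_cylindersI.
- by rewrite preimage_setT setTI probability_setT mul1e.
- move=> _ [C mC <-].
  pose C' i := if (i < n)%N then C i else B.
  have mC' i : measurable (C' i) by rewrite /C'; case: ifP.
  have C'E (i : 'I_n) : C' i = C i by rewrite /C' ltn_ord.
  have := iid.1 n.+1 C' mC'; rewrite !big_ord_recr /= {2 4}/C' ltnn -iid.1//.
  by under eq_bigr do rewrite C'E; rewrite !prefix_cylinder.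
- move=> S mS; rewrite -[prefix n @^-1` (~` S)]/(~` (prefix n @^-1` S)).
  move: (prefix n @^-1` S) (mpre _ mS) => U mU indepU.
  rewrite probability_setC// setIC -setDE measureD//; last first.
    exact: le_lt_trans (probability_le1 P mE) (ltry _).
  by rewrite setIC [X in (_ - X)%E]indepU muleBl ?mul1e// ?fin_num_measure// fin_num_adde_defr.
- move=> F mF trivF indepF.
  have mpreF k : measurable (prefix n @^-1` F k) by exact: mpre.
  have triv_pre : trivIset setT (fun k => prefix n @^-1` F k).
    by move=> i j _ _ [w [Fi Fj]]; apply: trivF => //; exists (prefix n w).
  rewrite preimage_bigcup setI_bigcupl !measure_bigcup//; last 2 first.
  - by move=> k _; exact: measurableI.
  - exact: trivIset_setIr.
  rewrite muleC -(fineK (fin_num_measure P _ mE)) -nneseriesZl//.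
  by apply: eq_eseriesr => k _; rewrite fineK ?fin_num_measure// muleC; exact: indepF.
Qed.

Lemma indep_iid_sum n (f : nat -> R -> R) : (forall j, measurable_fun setT (f j)) ->
  indep_rv P (fun w => \sum_(j < n) f j (xi j w)) (fun w => f n (xi n w)).
Proof.
move=> mf; pose sum_tuple (t : n.-tuple R) := \sum_(j < n) f j (tnth t j).
rewrite (_ : (fun w => _) = sum_tuple \o prefix n); last first.
  by apply/funext => w; apply: eq_bigr => j _; rewrite tnth_mktuple.
apply: (@indep_rv_comp _ _ _ _ _ _ _ _ _ _ _ P _ (xi n) sum_tuple (f n)) => //.
  by apply: measurable_sum => j; exact: measurableT_comp (mf j) (measurable_tnth j).
exact: indep_prefix.
Qed.

Lemma measurable_iid_sum n (f : nat -> R -> R) : (forall j, measurable_fun setT (f j)) ->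
  measurable_fun setT (fun w => \sum_(j < n) f j (xi j w)).
Proof. by move=> mf; apply: measurable_sum => j; exact: measurableT_comp (mf j) _. Qed.

Lemma indep_iid01 : indep_rv P (xi 0%N) (xi 1%N).
Proof.
have mcoord (j : nat) : measurable_fun setT (fun x : R => x) by exact: measurable_id.
have := indep_iid_sum 1 mcoord; congr (indep_rv P _ _).
by apply/funext => w; rewrite big_ord1.
Qed.

End iid_sequences.

Section characteristic_function.
Context {R : realType} {d : measure_display} {T : measurableType d}.
Variable P : probability T R.
Implicit Types X Y : T -> R.

(* The squared modulus of the characteristic function of [X] at [1]. *)
Definition charfun_sqr X : R := (\int[P]_w cos (X w)) ^+ 2 + (\int[P]_w sin (X w)) ^+ 2.

Lemma charfun_sqr_ge0 X : 0 <= charfun_sqr X.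
Proof. by rewrite addr_ge0 ?sqr_ge0. Qed.

Section independent_pair.
Variables X Y : T -> R.
Hypotheses (mX : measurable_fun setT X) (mY : measurable_fun setT Y).
Hypothesis indep : indep_rv P X Y.

Let integrable_comp (f : R -> R) (Z : T -> R) : measurable_fun setT f ->
  (forall x, `|f x| <= 1) -> measurable_fun setT Z ->
  P.-integrable setT (EFin \o (fun w => f (Z w))).
Proof.
by move=> mf f_le1 mZ; apply: integrable_le1 => //; exact: measurableT_comp mf mZ.
Qed.

Let integral_trigM (f g : R -> R) :
  measurable_fun setT f -> (forall x, `|f x| <= 1) ->
  measurable_fun setT g -> (forall x, `|g x| <= 1) ->
  \int[P]_w (f (X w) * g (Y w)) = \int[P]_w f (X w) * \int[P]_w g (Y w) /\
  P.-integrable setT (EFin \o (fun w => f (X w) * g (Y w))).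
Proof.
move=> mf f_le1 mg g_le1; have mfX := measurableT_comp mf mX; have mgY := measurableT_comp mg mY.
split.
  apply: Rintegral_indepM => //; [exact: (indep_rv_comp mf mg indep) | |]; exact: integrable_comp.
apply: integrable_le1 => [|w]; first exact: measurable_funM.
by rewrite normrM mulr_ile1.
Qed.

Lemma charfun_sqrD : charfun_sqr (fun w => X w + Y w) = charfun_sqr X * charfun_sqr Y.
Proof.
have [cc icc] := integral_trigM (@measurable_cos R) (@cos_max R) (@measurable_cos R) (@cos_max R).
have [cs ics] := integral_trigM (@measurable_cos R) (@cos_max R) (@measurable_sin R) (@sin_max R).
have [sc isc] := integral_trigM (@measurable_sin R) (@sin_max R) (@measurable_cos R) (@cos_max R).
have [ss iss] := integral_trigM (@measurable_sin R) (@sin_max R) (@measurable_sin R) (@sin_max R).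
rewrite /charfun_sqr; under eq_Rintegral do rewrite cosD.
under [X in _ + X ^+ 2 = _]eq_Rintegral do rewrite sinD.
by rewrite RintegralB// RintegralD// cc cs sc ss; ring.
Qed.

Lemma charfun_sqr_symmetrized :
  \int[P]_w cos (Y w) = \int[P]_w cos (X w) -> \int[P]_w sin (Y w) = \int[P]_w sin (X w) ->
  charfun_sqr X = \int[P]_w cos (X w - Y w).
Proof.
move=> cosE sinE.
have [cc icc] := integral_trigM (@measurable_cos R) (@cos_max R) (@measurable_cos R) (@cos_max R).
have [ss iss] := integral_trigM (@measurable_sin R) (@sin_max R) (@measurable_sin R) (@sin_max R).
under [RHS]eq_Rintegral do rewrite cosB.
by rewrite RintegralD// cc ss cosE sinE /charfun_sqr !expr2.
Qed.

End independent_pair.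
End characteristic_function.

Section iid_characteristic_function.
Context {R : realType} {d : measure_display} {T : measurableType d}.
Variables (P : probability T R) (xi : nat -> {RV P >-> R}).
Hypothesis iid : iid_seq xi.
Implicit Types (c : nat -> R) (n : nat).

Lemma Rintegral_iid k (f : R -> R) : measurable_fun setT f ->
  \int[P]_w f (xi k w) = \int[P]_w f (xi 0%N w).
Proof.
move=> mf; rewrite /Rintegral (@integral_iid _ _ _ _ _ iid k (EFin \o f))//.
exact/measurable_EFinP.
Qed.

Let mscale (s : R) : measurable_fun setT (fun x : R => s * x).
Proof. exact: measurable_funM. Qed.

Lemma charfun_sqr_iid k s :
  charfun_sqr P (fun w => s * xi k w) = \int[P]_w cos (s * (xi 0%N w - xi 1%N w)).
Proof.
have mcos := measurableT_comp (@measurable_cos R) (mscale s).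
have msin := measurableT_comp (@measurable_sin R) (mscale s).
rewrite /charfun_sqr (Rintegral_iid k mcos) (Rintegral_iid k msin) -/(charfun_sqr P _).
have indep := indep_rv_comp (mscale s) (mscale s) (indep_iid01 iid).
have mscale_xi j := measurableT_comp (mscale s) (measurable_funPT (xi j)).
rewrite (charfun_sqr_symmetrized (mscale_xi 0%N) (mscale_xi 1%N) indep)//=.
- by under eq_Rintegral do rewrite -mulrBr.
- exact: (Rintegral_iid 1 mcos).
- exact: (Rintegral_iid 1 msin).
Qed.

Lemma charfun_sqr_sum c n : charfun_sqr P (fun w => \sum_(j < n) c j * xi j w) =
  \prod_(j < n) \int[P]_w cos (c j * (xi 0%N w - xi 1%N w)).
Proof.
have mc (j : nat) := mscale (c j).
elim: n => [|n ih].
  rewrite big_ord0 /charfun_sqr; under eq_Rintegral do rewrite big_ord0 cos0.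
  under [X in _ + X ^+ 2]eq_Rintegral do rewrite big_ord0 sin0.
  by rewrite !Rintegral_probability_cst expr0n expr1n addr0.
rewrite big_ord_recr/= -ih -(charfun_sqr_iid n).
have mlast := measurableT_comp (mc n) (measurable_funPT (xi n)).
rewrite -(charfun_sqrD (measurable_iid_sum xi n mc) mlast (indep_iid_sum iid n mc)).
by congr charfun_sqr; apply/funext => w; rewrite big_ord_recr.
Qed.

Let integrable_cos_diff s :
  P.-integrable setT (EFin \o (fun w => cos (s * (xi 0%N w - xi 1%N w)))).
Proof. by apply: integrable_cos; apply: measurable_funM => //; exact: measurable_funB. Qed.

Let integrable_cst1 : P.-integrable setT (EFin \o (fun=> 1 : R)).
Proof. exact: finite_measure_integrable_cst. Qed.

Let integrable_one_minus_cos s :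
  P.-integrable setT (EFin \o (fun w => 1 - cos (s * (xi 0%N w - xi 1%N w)))).
Proof. exact: (integrableB measurableT integrable_cst1 (integrable_cos_diff s)). Qed.

Lemma charfun_sqr_sum_le c n : charfun_sqr P (fun w => \sum_(j < n) c j * xi j w) <=
  expR (- \int[P]_w (\sum_(j < n) (1 - cos (c j * (xi 0%N w - xi 1%N w))))).
Proof.
rewrite Rintegral_sum => [|j]; last exact: integrable_one_minus_cos.
rewrite -sumrN expR_sum charfun_sqr_sum; apply: ler_prod => j _; apply/andP; split.
  by rewrite -(charfun_sqr_iid 0) charfun_sqr_ge0.
rewrite RintegralB// Rintegral_probability_cst opprB.
by apply: le_trans (expR_ge1Dx _); rewrite addrC subrK.
Qed.

Lemma expect_cos_sum_le c n (L p g M : R) : 0 <= L ->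
  p <= fine (P [set w | g <= `|xi 0%N w - xi 1%N w| <= M]) ->
  (forall y, g <= `|y| <= M -> L <= \sum_(j < n) (1 - cos (c j * y))) ->
  \int[P]_w cos (\sum_(j < n) c j * xi j w) <= expR (- (p * L / 2)).
Proof.
move=> L_ge0; set A := [set w | _] => p_le sum_ge.
have mdiff : measurable_fun setT (fun w => xi 0%N w - xi 1%N w) by exact: measurable_funB.
have mA : measurable A by apply: measurable_set_between; exact: measurableT_comp.
have sum_integral_ge :
    p * L <= \int[P]_w (\sum_(j < n) (1 - cos (c j * (xi 0%N w - xi 1%N w)))).
  apply: (@le_trans _ _ (\int[P]_w (L * \1_A w))).
    rewrite RintegralZl//; last exact: integrable_indic.
    by rewrite Rintegral_indic// mulrC ler_wpM2l.
  apply: le_Rintegral => //.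
  - exact: (integrableZl measurableT L (integrable_indic P mA)).
  - by apply: integrable_sumr => j; exact: integrable_one_minus_cos.
  - move=> w _; rewrite indicE; case: (boolP (w \in A)) => [|_].
      by rewrite inE mulr1 => /sum_ge.
    by rewrite mulr0 sumr_ge0// => j _; rewrite subr_ge0 cos_le1.
set C := \int[P]_w _; have [C_le0|C_gt0] := leP C 0.
  exact: le_trans C_le0 (expR_ge0 _).
rewrite -ler_sqr ?nnegrE ?expR_ge0 ?(ltW C_gt0)// -expRM_natl.
apply: (@le_trans _ _ (charfun_sqr P (fun w => \sum_(j < n) c j * xi j w))).
  by rewrite lerDl sqr_ge0.
by apply: le_trans (charfun_sqr_sum_le c n) _; rewrite ler_expR; lra.
Qed.

End iid_characteristic_function.

Section gaussian_sums.
Context {R : realType}.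
Implicit Types (q decay : R) (N : nat).

Lemma sum_geom_dist q b N : 0 <= q <= 1 ->
  (1 - q) * \sum_(a < N) q ^+ ((a - b) + (b - a)) <= 2.
Proof.
move=> /andP[q_ge0 q_le1].
pose S N := (1 - q) * \sum_(a < N) q ^+ ((a - b) + (b - a)).
have S_recr m : S m.+1 = S m + (1 - q) * q ^+ ((m - b) + (b - m)).
  by rewrite /S big_ord_recr/= mulrDr.
have left_part m : (m <= b)%N -> S m <= q ^+ (b - m).+1.
  elim: m => [|m ih] mb; first by rewrite /S big_ord0 mulr0 exprn_ge0.
  rewrite S_recr (eqP (ltnW mb)) add0n (le_trans (lerD (ih (ltnW mb)) (lexx _)))//.
  by rewrite -(subSn mb) subSS exprS -mulrDl addrC subrK mul1r.
have right_part m : S (b + m)%N <= 2 - q ^+ m.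
  elim: m => [|m ih].
    by rewrite addn0 expr0 (le_trans (left_part _ (leqnn b)))// subnn expr1; lra.
  rewrite addnS S_recr addKn -[X in (m + X)%N]subn0 -{2}(addn0 b) subnDl subn0 sub0n addn0.
  by rewrite exprS (le_trans (lerD ih (lexx _)))//; lra.
have [Nb|/ltnW bN] := leqP N b.
  rewrite -/(S N) (le_trans (left_part _ Nb))//.
  by rewrite (@le_trans _ _ 1) ?exprn_ile1//; lra.
rewrite -/(S N) -(subnKC bN) (le_trans (right_part _))//.
by have := exprn_ge0 (N - b) q_ge0; lra.
Qed.

Definition gauss_const decay : R := 2 / (1 - expR (- decay)).

Lemma gauss_const_gt0 decay : 0 < decay -> 0 < gauss_const decay.
Proof. by move=> decay_gt0; rewrite divr_gt0// subr_gt0 expR_lt1 oppr_lt0. Qed.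

Lemma sum_gauss_le decay N : 0 < decay ->
  \sum_(a < N) \sum_(b < N) expR (- (decay * (a%:R - b%:R) ^+ 2)) <=
  N%:R * gauss_const decay.
Proof.
move=> decay_gt0; rewrite /gauss_const; set q := expR (- decay).
have q_lt1 : q < 1 by rewrite expR_lt1 oppr_lt0.
have q01 : 0 <= q <= 1 by rewrite expR_ge0 ltW.
rewrite exchange_big/= mulr_natl -[X in _ *+ X]card_ord -sumr_const.
apply: ler_sum => b _; rewrite ler_pdivlMr ?subr_gt0// mulrC.
apply: le_trans (sum_geom_dist b N q01).
apply: ler_wpM2l; first by rewrite subr_ge0 ltW.
apply: ler_sum => a _.
rewrite /q -expRM_natl ler_expR mulrN lerN2 [leLHS]mulrC ler_pM2l//.
set m := ((a - b) + (b - a))%N.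
have -> : (a%:R - b%:R) ^+ 2 = (m%:R : R) ^+ 2.
  have [ab|/ltnW ab] := leqP a b.
    by rewrite /m (eqP ab) add0n natrB// -sqrrN opprB.
  by rewrite /m (eqP ab) addn0 natrB.
by rewrite -natrX ler_nat; case: (m) => // l; rewrite expnS expn1 leq_pmulr.
Qed.

Lemma sum_gauss2_le decay N : 0 < decay ->
  \sum_(i : 'I_N * 'I_N) \sum_(j : 'I_N * 'I_N)
    expR (- (decay * ((i.1%:R - j.1%:R) ^+ 2 + (i.2%:R - j.2%:R) ^+ 2))) <=
  (N%:R * gauss_const decay) ^+ 2.
Proof.
move=> decay_gt0; pose e (a b : 'I_N) := expR (- (decay * (a%:R - b%:R) ^+ 2)).
have -> : \sum_(i : 'I_N * 'I_N) \sum_(j : 'I_N * 'I_N)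
    expR (- (decay * ((i.1%:R - j.1%:R) ^+ 2 + (i.2%:R - j.2%:R) ^+ 2))) =
    (\sum_a \sum_b e a b) ^+ 2.
  rewrite expr2 [RHS]big_distrlr/= [RHS]pair_big/=; apply: eq_bigr => -[a1 a2] _.
  rewrite [RHS]big_distrlr/= [RHS]pair_big/=; apply: eq_bigr => -[b1 b2] _.
  by rewrite /e -expRD; congr expR; rewrite /=; ring.
rewrite ler_pXn2r ?nnegrE ?sum_gauss_le//.
  by apply: sumr_ge0 => a _; apply: sumr_ge0 => b _; exact: expR_ge0.
by rewrite mulr_ge0// ltW// gauss_const_gt0.
Qed.

Lemma sum_cos_diff (I : finType) (x : I -> R) :
  \sum_i \sum_j cos (x i - x j) =
  (\sum_i cos (x i)) ^+ 2 + (\sum_i sin (x i)) ^+ 2.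
Proof.
rewrite !expr2 !mulr_suml -big_split/=; apply: eq_bigr => i _.
by rewrite !mulr_sumr -big_split/=; apply: eq_bigr => j _; rewrite cosB.
Qed.

End gaussian_sums.

(* A smoothing inequality: the squared modulus of [\sum_i expR ('i * x i)] is
   everywhere nonnegative and at least [#|I| ^ 2 / 4] on [A]. *)
Lemma probability_le_sum_cos {R : realType} {d : measure_display} {T : measurableType d}
    (P : probability T R) (I : finType) (x : I -> T -> R) (A : set T) :
  (0 < #|I|)%N -> measurable A -> (forall i, measurable_fun setT (x i)) ->
  (forall i w, A w -> x i w ^+ 2 <= 1) ->
  fine (P A) <= 4 / #|I|%:R ^+ 2 * \sum_i \sum_j \int[P]_w cos (x i w - x j w).
Proof.
move=> I_gt0 mA mx x_le1; have IR : 0 < #|I|%:R :> R by rewrite ltr0n.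
have icos i j : P.-integrable setT (EFin \o (fun w => cos (x i w - x j w))).
  by apply: integrable_cos; exact: measurable_funB.
have isum i : P.-integrable setT (EFin \o (fun w => \sum_j cos (x i w - x j w))).
  exact: integrable_sumr.
under eq_bigr do rewrite -Rintegral_sum//.
rewrite -Rintegral_sum// -RintegralZl//; last exact: integrable_sumr.
rewrite -Rintegral_indic//; apply: le_Rintegral => //.
- exact: integrable_indic.
- exact: (integrableZl measurableT _ (integrable_sumr _ isum)).
move=> w _; rewrite (sum_cos_diff (x ^~ w)) indicE.
have [|_] := boolP (w \in A); last first.
  by rewrite mulr_ge0 ?addr_ge0 ?sqr_ge0// divr_ge0// sqr_ge0.
rewrite inE => Aw; have half_le : #|I|%:R / 2 <= \sum_i cos (x i w).
  have -> : #|I|%:R / 2 = \sum_(i : I) (1 / 2 : R).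
    by rewrite sumr_const -[RHS]mulr_natl mul1r.
  by apply: ler_sum => i _; have := one_minus_cos_le (x i w); have := x_le1 i w Aw; lra.
rewrite mulrAC ler_pdivlMr ?exprn_gt0// mul1r.
have := sqr_ge0 (\sum_i sin (x i w)); nra.
Qed.

Section separation.
Context {R : realType} {d : measure_display} {T : measurableType d}.
Variable P : probability T R.

Lemma measurable_dist_le (u a : R) : measurable [set x : R | `|x - u| <= a].
Proof.
by apply: measurable_setle => //; apply: measurableT_comp => //; exact: measurable_funB.
Qed.

Lemma exists_charged_interval (X : {RV P >-> R}) :
  exists u : R, (0 < P [set w | (`|X w - u| <= 1 / 2)%R])%E.
Proof.
apply: contrapT => no_charge.
have mI u : measurable [set w | `|X w - u| <= 1 / 2].
  exact: (measurable_funPTI X (measurable_dist_le u (1 / 2))).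
have negligible_interval u : P.-negligible [set w | `|X w - u| <= 1 / 2].
  apply/negligibleP => //; apply/eqP; rewrite eq_le measure_ge0 andbT leNgt.
  by apply/negP => charged; apply: no_charge; exists u.
pose F k := [set w | `|X w - k%:R / 2| <= 1 / 2] `|`
            [set w | `|X w - (- (k%:R / 2))| <= 1 / 2].
have negligible_cover : P.-negligible (\bigcup_k F k).
  by apply: negligible_bigcup => k; exact: negligibleU.
have : P.-negligible [set: T].
  apply: negligibleS negligible_cover => w _; exists (Num.truncn (2 * `|X w|)) => //.
  have /truncn_itv/andP : 0 <= 2 * `|X w| by rewrite mulr_ge0.
  set k := Num.truncn _ => -[k_le lt_k]; rewrite -natr1 in lt_k.
  have [X_ge0|X_lt0] := leP 0 (X w).
    by left => /=; rewrite ger0_norm// in k_le lt_k; rewrite ler_norml; lra.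
  by right => /=; rewrite ltr0_norm// in k_le lt_k; rewrite ler_norml; lra.
move=> /negligibleP -/(_ measurableT) /eqP.
by rewrite [X in X == _](probability_setT P) onee_eq0.
Qed.

Lemma condH_charged (X : {RV P >-> R}) : condH X -> exists2 M : R, 0 < M &
  forall u, (0 < P [set w | (1 < `|X w - u|)%R /\ (`|X w| <= M)%R])%E.
Proof.
move=> [M [q [M_gt0 [/andP[q_gt0 q_lt1] [conc tail]]]]]; exists M => // u.
have mX (B : set R) : measurable B -> measurable (X @^-1` B).
  by move=> mB; exact: measurable_funPTI.
have mtail : measurable [set x : R | M < `|x|].
  by apply: measurable_setlt => //; exact: measurableT_comp.
pose J := [set x : R | `|x - u| <= 1] `|` [set x : R | M < `|x|].
have mJ : measurable J by apply: measurableU => //; exact: measurable_dist_le.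
have PJ : (P (X @^-1` J) <= (1 - q / 2)%:E)%E.
  rewrite preimage_setU (le_trans (measureU2 _ (mX _ (measurable_dist_le u 1)) (mX _ mtail)))//.
  have -> : (1 - q / 2)%:E = ((1 - q)%:E + (q / 2)%:E)%E by rewrite -EFinD; congr EFin; lra.
  exact: leeD (conc u) tail.
have : (0 < P (X @^-1` (~` J)))%E.
  rewrite -preimage_setC probability_setC; last exact: mX.
  move: PJ; rewrite -(fineK (fin_num_measure P _ (mX _ mJ))) -EFinB !lee_fin lte_fin; lra.
congr (_ < P _)%E; apply/seteqP; split=> w /=.
  by move=> /not_orP[/negP + /negP]; rewrite -ltNge -leNgt.
by move=> [far bounded] [|]; apply/negP; rewrite -?ltNge -?leNgt.
Qed.

End separation.

Section grids.
Context {R : realType}.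
Implicit Types (n N : nat) (s t y c e g : R).

Lemma exists_grid n s : (0 < n)%N -> 0 < s -> 2 * s <= Num.sqrt n%:R ->
  exists N, [/\ (0 < N)%N, N%:R <= Num.sqrt n%:R / (2 * s) :> R &
    N%:R^-1 <= 4 * s / Num.sqrt n%:R :> R].
Proof.
move=> n_gt0 s_gt0 s_le; set r := Num.sqrt n%:R in s_le *.
have r_gt0 : 0 < r by rewrite sqrtr_gt0 ltr0n.
have [|N N_gt0 /andP[N_ge N_le]] := @exists_nat_half_le _ (r / (2 * s)).
  by rewrite ler_pdivlMr ?mulr_gt0// mul1r.
exists N; split=> //; have NR : 0 < N%:R :> R by rewrite ltr0n.
rewrite -[leRHS]invrK lef_pV2 ?posrE ?invr_gt0 ?divr_gt0 ?mulr_gt0//.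
by apply: le_trans N_ge; apply: eq_ler; field; rewrite !gt_eqF.
Qed.

Lemma grid_step_le n N t s (i : 'I_N) y : 0 < s -> t <= s ->
  N%:R <= Num.sqrt n%:R / (2 * s) -> `|y| <= t -> `|i%:R / Num.sqrt n%:R * y| <= 1 / 2.
Proof.
move=> s_gt0 ts N_le y_le; set r := Num.sqrt n%:R in N_le *.
have r_ge0 : 0 <= r by exact: sqrtr_ge0.
rewrite normrM ger0_norm ?divr_ge0//.
apply: (@le_trans _ _ (N%:R / r * s)).
  by rewrite ler_pM ?divr_ge0// ?(le_trans y_le)// ler_wpM2r ?invr_ge0// ler_nat ltnW.
move: r_ge0; rewrite le_eqVlt => /predU1P[<-|r_gt0].
  by rewrite invr0 mulr0 mul0r divr_ge0.
by rewrite mulrAC ler_pdivrMr//; move: N_le; rewrite ler_pdivlMr ?mulr_gt0//; lra.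
Qed.

Lemma grid_sqr_le n N s (i j : 'I_N) : (0 < n)%N -> 0 < s ->
  N%:R <= Num.sqrt n%:R / (2 * s) ->
  s ^+ 2 * ((i%:R - j%:R) / Num.sqrt n%:R) ^+ 2 <= 1 / 4.
Proof.
move=> n_gt0 s_gt0 N_le; set r := Num.sqrt n%:R in N_le *.
have r_gt0 : 0 < r by rewrite sqrtr_gt0 ltr0n.
have dist_le : (i%:R - j%:R : R) ^+ 2 <= (r / (2 * s)) ^+ 2.
  rewrite -[leLHS]real_normK ?num_real// ler_sqr ?nnegrE ?(le_trans _ N_le)//.
  rewrite ler_norml.
  have : i%:R <= N%:R :> R by rewrite ler_nat ltnW.
  have : j%:R <= N%:R :> R by rewrite ler_nat ltnW.
  by have := ler0n R i; have := ler0n R j; move=> *; apply/andP; split; lra.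
rewrite exprMn mulrA exprVn ler_pdivrMr ?exprn_gt0//.
have -> : 1 / 4 * r ^+ 2 = s ^+ 2 * (r / (2 * s)) ^+ 2 by field; rewrite gt_eqF.
by rewrite ler_wpM2l ?sqr_ge0.
Qed.

Lemma grid_average_le N c e g : (0 < N)%N -> N%:R^-1 <= c ->
  4 / (N%:R * N%:R) ^+ 2 * (N%:R ^+ 4 * e + (N%:R * g) ^+ 2) <= 4 * e + 4 * g ^+ 2 * c ^+ 2.
Proof.
move=> N_gt0 N_ge; have NV_ge0 : 0 <= N%:R^-1 :> R by rewrite invr_ge0.
have -> : 4 / (N%:R * N%:R) ^+ 2 * (N%:R ^+ 4 * e + (N%:R * g) ^+ 2) =
    4 * e + 4 * g ^+ 2 * N%:R^-1 ^+ 2 by field; rewrite pnatr_eq0 -lt0n.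
rewrite lerD2l ler_wpM2l//; first by rewrite mulr_ge0// sqr_ge0.
by rewrite ler_sqr ?nnegrE// (le_trans NV_ge0).
Qed.

End grids.

Section separated_pair.
Context {R : realType} {d : measure_display} {T : measurableType d}.
Variables (P : probability T R) (xi : nat -> {RV P >-> R}).
Hypothesis iid : iid_seq xi.

Definition separated p M :=
  p <= fine (P [set w | 1 / 2 <= `|xi 0%N w - xi 1%N w| <= M]).

Lemma condH_separated : condH (xi 0%N) -> exists p M : R, [/\ 0 < p, 1 <= M & separated p M].
Proof.
move=> /condH_charged[M M_gt0 charged_outside].
have [u charged_near] := exists_charged_interval (xi 0%N).
pose near := [set x : R | `|x - u| <= 1 / 2].
pose far := [set x : R | 1 < `|x - u| /\ `|x| <= M].
have mdist : measurable_fun setT (fun x : R => `|x - u|).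
  by apply: measurableT_comp => //; exact: measurable_funB.
have mnear : measurable near by exact: measurable_setle.
have mfar : measurable far.
  apply: measurableI; first exact: measurable_setlt.
  by apply: measurable_setle => //; exact: measurableT_comp.
have PE : P (xi 0%N @^-1` near `&` xi 1%N @^-1` far) =
    (P (xi 0%N @^-1` near) * P (xi 0%N @^-1` far))%E.
  by rewrite (indep_iid01 iid)//; congr (_ * _)%E; exact: iid.2.
set E := _ `&` _ in PE.
have mE : measurable E by apply: measurableI; exact: measurable_funPTI.
have mnorm : measurable_fun setT (fun w => `|xi 0%N w - xi 1%N w|).
  by apply: measurableT_comp => //; exact: measurable_funB.
exists (fine (P E)), (`|u| + 1 / 2 + M + 1); split.
- rewrite fine_gt0//; apply/andP; split; last by rewrite ltey_eq fin_num_measure.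
  by rewrite PE mule_gt0 ?charged_near ?charged_outside.
- by have := normr_ge0 u; lra.
have mS : measurable [set w | 1 / 2 <= `|xi 0%N w - xi 1%N w| <= `|u| + 1 / 2 + M + 1].
  exact: measurable_set_between.
rewrite /separated fine_le ?fin_num_measure// le_measure ?inE// => w [/= near_w [far_w bounded_w]].
have x1E : xi 1%N w - u = (xi 1%N w - xi 0%N w) + (xi 0%N w - u) by ring.
have diffE : xi 0%N w - xi 1%N w = (xi 0%N w - u) + (u - xi 1%N w) by ring.
apply/andP; split.
  have := ler_normD (xi 1%N w - xi 0%N w) (xi 0%N w - u).
  by rewrite -x1E (distrC (xi 1%N w) (xi 0%N w)); rewrite /near/= in near_w; lra.
rewrite diffE; have := ler_normD (xi 0%N w - u) (u - xi 1%N w).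
by have := ler_normB u (xi 1%N w); rewrite /near/= in near_w; lra.
Qed.

End separated_pair.

Section dft_measurability.
Context {R : realType} {d : measure_display} {T : measurableType d}.
Variable X : nat -> T -> R.
Hypothesis mX : forall j, measurable_fun setT (X j).
Implicit Types (n k : nat) (t a : R).

Lemma measurable_dft_re n k : measurable_fun setT (fun w => dft_re n k (X ^~ w)).
Proof. by apply: measurable_sum => j; exact: measurable_funM. Qed.

Lemma measurable_dft_im n k : measurable_fun setT (fun w => dft_im n k (X ^~ w)).
Proof. by apply: measurable_sum => j; exact: measurable_funM. Qed.

Definition small_dft n k t : set T :=
  [set w | `|dft_re n k (X ^~ w)| <= t /\ `|dft_im n k (X ^~ w)| <= t].

Lemma measurable_small_dft n k t : measurable (small_dft n k t).
Proof.
apply: measurableI; apply: measurable_setle => //; apply: measurableT_comp => //.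
  exact: measurable_dft_re.
exact: measurable_dft_im.
Qed.

Definition large_dft n k a : set T :=
  [set w | a <= `|dft_re n k (X ^~ w)| \/ a <= `|dft_im n k (X ^~ w)|].

Lemma measurable_large_dft n k a : measurable (large_dft n k a).
Proof.
apply: measurableU; apply: measurable_setle => //; apply: measurableT_comp => //.
  exact: measurable_dft_re.
exact: measurable_dft_im.
Qed.

Lemma measurable_exists_large_dft n a : measurable [set w | exists k : 'I_n, large_dft n k a w].
Proof.
apply: (measurable_exists_ord n (A := fun k => large_dft n k a)) => k.
exact: measurable_large_dft.
Qed.

Lemma measurable_kappa_circulant n (c : R) : (0 < n)%N -> 0 <= c ->
  measurable [set w | (kappa (circulant n (X ^~ w)) <= c%:E)%E].
Proof.
move=> n_gt0 c_ge0.
have mdft k : measurable_fun setT (fun w => dft_sqr n k (X ^~ w)).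
  by apply: measurable_funD; apply: measurable_funX;
    [exact: measurable_dft_re | exact: measurable_dft_im].
have msqrt k : measurable_fun setT (fun w => Num.sqrt (dft_sqr n k (X ^~ w))).
  apply: (measurableT_comp _ (mdft k)); apply: continuous_measurable_fun.
  exact: sqrt_continuous.
rewrite (_ : [set w | _] =
  ~` ([set w | exists k : 'I_n, dft_sqr n k (X ^~ w) <= 0] `|`
      [set w | exists k : 'I_n, exists l : 'I_n,
        c * Num.sqrt (dft_sqr n l (X ^~ w)) < Num.sqrt (dft_sqr n k (X ^~ w))])).
  apply: measurableC; apply: measurableU.
    by apply: (measurable_exists_ord n (A := fun k => [set w | dft_sqr n k (X ^~ w) <= 0])) => k;
      exact: measurable_setle.
  pose A k l := [set w | c * Num.sqrt (dft_sqr n l (X ^~ w)) < Num.sqrt (dft_sqr n k (X ^~ w))].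
  apply: (measurable_exists_ord n (A := fun k => [set w | exists l : 'I_n, A k l w])) => k.
  apply: (measurable_exists_ord n (A := A k)) => l; apply: measurable_setlt => //.
  exact: measurable_funM.
apply/seteqP; split=> w /=.
  move=> /kappa_circulant_le -/(_ n_gt0 c_ge0)[dft_gt0 dft_le] [[k]|[k [l]]].
    by rewrite leNgt dft_gt0.
  by rewrite ltNge dft_le.
move=> /not_orP[no_zero no_gap]; apply/kappa_circulant_le => //; split=> [k|k l].
  by rewrite ltNge; apply/negP => le0; apply: no_zero; exists k.
by rewrite leNgt; apply/negP => gap; apply: no_gap; exists k, l.
Qed.

End dft_measurability.

Section small_ball_bounds.
Context {R : realType} {d : measure_display} {T : measurableType d}.
Variables (P : probability T R) (xi : nat -> {RV P >-> R}) (p M : R).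
Hypothesis iid : iid_seq xi.
Hypothesis p_gt0 : 0 < p.
Hypothesis M_ge1 : 1 <= M.
Hypothesis sep : separated xi p M.
Implicit Types (n k N : nat) (a b s t : R).

Local Notation re n k w := (dft_re n k (fun j => xi j w)).
Local Notation im n k w := (dft_im n k (fun j => xi j w)).

Let M_gt0 : 0 < M. Proof. exact: lt_le_trans M_ge1. Qed.

Let mre n k : measurable_fun setT (fun w => re n k w).
Proof. exact: measurable_dft_re. Qed.

Let mim n k : measurable_fun setT (fun w => im n k w).
Proof. exact: measurable_dft_im. Qed.

Lemma expect_cos_dft_le n k a b L : 0 <= L ->
  (forall y, 1 / 4 <= y ^+ 2 <= M ^+ 2 ->
    L <= \sum_(j < n) (1 - cos (trig_form n k (a * y) (b * y) j))) ->
  \int[P]_w cos (a * re n k w + b * im n k w) <= expR (- (p * L / 2)).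
Proof.
move=> L_ge0 L_le; under eq_Rintegral do rewrite -sum_trig_form.
apply: (expect_cos_sum_le iid L_ge0 sep) => y /andP[y_ge y_le].
have /L_le : 1 / 4 <= y ^+ 2 <= M ^+ 2.
  rewrite -[y ^+ 2]real_normK ?num_real//.
  by apply/andP; split; [|rewrite ler_sqr ?nnegrE// ltW]; nra.
by under eq_bigr do rewrite -trig_form_scale.
Qed.

Lemma expect_cos_dft_complex n k a b : (0 < n)%N -> ~~ (n %| k.*2)%N ->
  M ^+ 2 * (a ^+ 2 + b ^+ 2) <= 1 \/
  64 * (M ^+ 2 * (a ^+ 2 + b ^+ 2)) * (gcdn k n)%:R ^+ 2 <= n%:R ^+ 2 ->
  \int[P]_w cos (a * re n k w + b * im n k w) <=
  expR (- (p * n%:R / 512 * Num.min 1 ((a ^+ 2 + b ^+ 2) / 4))).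
Proof.
move=> n_gt0 nk; set ab := a ^+ 2 + b ^+ 2.
have ab_ge0 : 0 <= ab by rewrite addr_ge0 ?sqr_ge0.
move=> small; pose L := n%:R / 256 * Num.min 1 (ab / 4).
have L_ge0 : 0 <= L.
  by rewrite mulr_ge0 ?divr_ge0 ?ler0n// le_min ler01 divr_ge0.
have -> : p * n%:R / 512 * Num.min 1 (ab / 4) = p * L / 2 by rewrite /L; field.
apply: expect_cos_dft_le => // y /andP[y_ge y_le].
have scaled : (a * y) ^+ 2 + (b * y) ^+ 2 = ab * y ^+ 2 by rewrite /ab; ring.
have scaled_le : ab * y ^+ 2 <= M ^+ 2 * ab by rewrite mulrC ler_wpM2r.
apply: le_trans (sum_one_minus_cos_ge n_gt0 nk _); rewrite scaled; last first.
  case: small => small; [left|right]; apply: le_trans small => //.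
  by rewrite ler_wpM2r ?sqr_ge0// ler_wpM2l.
rewrite ler_wpM2l ?divr_ge0 ?ler0n// le_min ge_min lexx ge_min; apply/orP; right.
by rewrite ler_wpM2l//; lra.
Qed.

Lemma expect_cos_dft_real n k a : (n %| k.*2)%N -> M ^+ 2 * a ^+ 2 <= 1 ->
  \int[P]_w cos (a * re n k w) <= expR (- (p / 32 * (n%:R * a ^+ 2))).
Proof.
move=> nk small; pose L := n%:R * a ^+ 2 / 16.
have -> : p / 32 * (n%:R * a ^+ 2) = p * L / 2 by rewrite /L; field.
have -> : \int[P]_w cos (a * re n k w) = \int[P]_w cos (a * re n k w + 0 * im n k w).
  by apply: eq_Rintegral => w _; rewrite mul0r addr0.
have na2_ge0 : 0 <= n%:R * a ^+ 2 by rewrite mulr_ge0// sqr_ge0.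
apply: expect_cos_dft_le => [|y /andP[y_ge y_le]]; first by rewrite /L divr_ge0.
rewrite mul0r; apply: le_trans (sum_one_minus_cos_real nk _); rewrite exprMn.
  by rewrite mulrA; have := ler_wpM2l na2_ge0 y_ge; rewrite /L; lra.
by apply: le_trans small; rewrite mulrC ler_wpM2r ?sqr_ge0.
Qed.

Lemma expect_cos_dft_complex_scale n k s a b : (0 < n)%N -> ~~ (n %| k.*2)%N ->
  M <= s \/ 6 * M * (gcdn k n)%:R <= n%:R * s -> s ^+ 2 * (a ^+ 2 + b ^+ 2) <= 1 / 2 ->
  \int[P]_w cos (a * re n k w + b * im n k w) <=
  expR (- (p * n%:R / 512)) + expR (- (p / 2048 * (n%:R * (a ^+ 2 + b ^+ 2)))).
Proof.
move=> n_gt0 nk cond; have : 0 <= a ^+ 2 + b ^+ 2 by rewrite addr_ge0 ?sqr_ge0.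
move=> ab_ge0 sab_le; apply: le_trans (expect_cos_dft_complex n_gt0 nk _) _.
  case: cond => cond; [left|right].
    have : M ^+ 2 <= s ^+ 2 by rewrite ler_sqr ?nnegrE ?(le_trans _ cond) ?(ltW M_gt0).
    by move=> /(ler_wpM2r ab_ge0); lra.
  have : (6 * M * (gcdn k n)%:R) ^+ 2 <= (n%:R * s) ^+ 2.
    have gcd_ge0 : 0 <= 6 * M * (gcdn k n)%:R by rewrite mulr_ge0// mulr_ge0// ltW.
    by rewrite ler_sqr ?nnegrE// (le_trans gcd_ge0).
  move=> /(ler_wpM2r ab_ge0) cond2; have := ler_wpM2l (sqr_ge0 (n%:R : R)) sab_le.
  have := sqr_ge0 (n%:R : R); rewrite !exprMn in cond2; lra.
set rho := a ^+ 2 + b ^+ 2; have [_|_] := leP 1 (rho / 4).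
  by rewrite mulr1 lerDl expR_ge0.
have -> : p * n%:R / 512 * (rho / 4) = p / 2048 * (n%:R * rho) by field.
by rewrite lerDr expR_ge0.
Qed.

Lemma expect_cos_grid_complex n k s N (i j : 'I_N * 'I_N) :
  (0 < n)%N -> ~~ (n %| k.*2)%N -> 0 < s -> N%:R <= Num.sqrt n%:R / (2 * s) ->
  M <= s \/ 6 * M * (gcdn k n)%:R <= n%:R * s ->
  \int[P]_w cos ((i.1%:R / Num.sqrt n%:R * re n k w + i.2%:R / Num.sqrt n%:R * im n k w) -
                 (j.1%:R / Num.sqrt n%:R * re n k w + j.2%:R / Num.sqrt n%:R * im n k w)) <=
  expR (- (p * n%:R / 512)) +
  expR (- (p / 2048 * ((i.1%:R - j.1%:R) ^+ 2 + (i.2%:R - j.2%:R) ^+ 2))).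
Proof.
move=> n_gt0 nk s_gt0 N_le cond; have nR : 0 < n%:R :> R by rewrite ltr0n.
set r := Num.sqrt n%:R in N_le *; have r2E : r ^+ 2 = n%:R by rewrite sqr_sqrtr.
pose a := (i.1%:R - j.1%:R) / r; pose b := (i.2%:R - j.2%:R) / r.
have a_le : s ^+ 2 * a ^+ 2 <= 1 / 4 by exact: grid_sqr_le N_le.
have b_le : s ^+ 2 * b ^+ 2 <= 1 / 4 by exact: grid_sqr_le N_le.
have -> : (i.1%:R - j.1%:R) ^+ 2 + (i.2%:R - j.2%:R) ^+ 2 = n%:R * (a ^+ 2 + b ^+ 2).
  by rewrite -r2E /a /b; field; rewrite gt_eqF// sqrtr_gt0.
rewrite (@eq_Rintegral _ _ _ _ _ (fun w => cos (a * re n k w + b * im n k w))); last first.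
  by move=> w _; rewrite /a /b; congr cos; ring.
by apply: (expect_cos_dft_complex_scale n_gt0 nk cond); lra.
Qed.

Lemma small_dft_le_complex n k s t : (0 < n)%N -> ~~ (n %| k.*2)%N ->
  0 < s -> t <= s -> 2 * s <= Num.sqrt n%:R ->
  M <= s \/ 6 * M * (gcdn k n)%:R <= n%:R * s ->
  fine (P (small_dft xi n k t)) <=
  4 * expR (- (p * n%:R / 512)) + 64 * gauss_const (p / 2048) ^+ 2 * s ^+ 2 / n%:R.
Proof.
move=> n_gt0 nk s_gt0 ts s_le cond; set e := expR _; set decay := p / 2048.
have decay_gt0 : 0 < decay by rewrite divr_gt0 ?p_gt0 ?ltr0n.
have [N [N_gt0 N_le N_ge]] := exists_grid n_gt0 s_gt0 s_le.
set r := Num.sqrt n%:R in N_ge; have r_gt0 : 0 < r by rewrite sqrtr_gt0 ltr0n.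
pose x (i : 'I_N * 'I_N) w := i.1%:R / r * re n k w + i.2%:R / r * im n k w.
have sum_le : \sum_i \sum_j \int[P]_w cos (x i w - x j w) <=
    N%:R ^+ 4 * e + (N%:R * gauss_const decay) ^+ 2.
  apply: le_trans (ler_sum _ (fun i _ => ler_sum _ (fun j _ =>
    expect_cos_grid_complex i j n_gt0 nk s_gt0 N_le cond))) _.
  under eq_bigr do rewrite big_split/=.
  rewrite big_split/=; apply: lerD; last exact: sum_gauss2_le.
  rewrite !sumr_const !card_prod !card_ord -!mulrnA -[leLHS]mulr_natl !natrM -/e.
  by apply: eq_ler; ring.
apply: le_trans (probability_le_sum_cos P (x := x) _ _ _ _) _.
- by rewrite card_prod card_ord muln_gt0 N_gt0.
- exact: measurable_small_dft.
- by move=> i; apply: measurable_funD; exact: measurable_funM.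
- move=> i w [re_le im_le]; rewrite -[_ ^+ 2]real_normK ?num_real// expr_le1//.
  apply: le_trans (ler_normD _ _) _.
  have := grid_step_le i.1 s_gt0 ts N_le re_le; have := grid_step_le i.2 s_gt0 ts N_le im_le.
  by rewrite -/r; lra.
rewrite card_prod card_ord natrM; apply: le_trans (ler_wpM2l _ sum_le) _.
  by rewrite divr_ge0 ?sqr_ge0.
apply: le_trans (grid_average_le e (gauss_const decay) N_gt0 N_ge) _.
rewrite lerD2l -[in leRHS](sqr_sqrtr (ler0n R n)) -/r.
by apply: eq_ler; field; rewrite gt_eqF.
Qed.

Lemma small_dft_le_real n k s t : (0 < n)%N -> (n %| k.*2)%N ->
  t <= s -> M <= s -> 2 * s <= Num.sqrt n%:R ->
  fine (P (small_dft xi n k t)) <= 16 * gauss_const (p / 32) * s / Num.sqrt n%:R.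
Proof.
move=> n_gt0 nk ts Ms s_le; set decay := p / 32.
have s_gt0 : 0 < s by exact: lt_le_trans Ms.
have decay_gt0 : 0 < decay by rewrite divr_gt0 ?p_gt0 ?ltr0n.
have nR : 0 < n%:R :> R by rewrite ltr0n.
have [N [N_gt0 N_le N_ge]] := exists_grid n_gt0 s_gt0 s_le.
have NR : 0 < N%:R :> R by rewrite ltr0n.
set r := Num.sqrt n%:R in N_ge *; have r2E : r ^+ 2 = n%:R by rewrite sqr_sqrtr.
have r_gt0 : 0 < r by rewrite sqrtr_gt0.
pose x (i : 'I_N) w := i%:R / r * re n k w.
have expect_le i j :
    \int[P]_w cos (x i w - x j w) <= expR (- (decay * (i%:R - j%:R) ^+ 2)).
  pose a := (i%:R - j%:R) / r.
  rewrite (@eq_Rintegral _ _ _ _ _ (fun w => cos (a * re n k w))); last first.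
    by move=> w _; rewrite /x /a; congr cos; ring.
  have -> : (i%:R - j%:R) ^+ 2 = n%:R * a ^+ 2 by rewrite /a -r2E; field; rewrite gt_eqF.
  apply: expect_cos_dft_real => //.
  have : M ^+ 2 <= s ^+ 2 by rewrite ler_sqr ?nnegrE ?(ltW M_gt0) ?(ltW s_gt0).
  move=> /(ler_wpM2r (sqr_ge0 a)).
  by have := grid_sqr_le i j n_gt0 s_gt0 N_le; rewrite -/r -/a; lra.
have sum_le : \sum_i \sum_j \int[P]_w cos (x i w - x j w) <= N%:R * gauss_const decay.
  apply: le_trans (ler_sum _ (fun i _ => ler_sum _ (fun j _ => expect_le i j))) _.
  exact: sum_gauss_le.
apply: le_trans (probability_le_sum_cos P (x := x) _ _ _ _) _.
- by rewrite card_ord.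
- exact: measurable_small_dft.
- by move=> i; exact: measurable_funM.
- move=> i w [re_le _]; rewrite -[_ ^+ 2]real_normK ?num_real// expr_le1//.
  by have := grid_step_le i s_gt0 ts N_le re_le; rewrite -/r; lra.
rewrite card_ord; apply: le_trans (ler_wpM2l _ sum_le) _; first by rewrite divr_ge0 ?sqr_ge0.
have -> : 4 / N%:R ^+ 2 * (N%:R * gauss_const decay) = 4 * gauss_const decay * N%:R^-1.
  by field; rewrite gt_eqF.
have -> : 16 * gauss_const decay * s / r = 4 * gauss_const decay * (4 * s / r) by ring.
by rewrite ler_wpM2l// mulr_ge0// ltW// gauss_const_gt0.
Qed.

Lemma small_dft_uniform : exists2 K : R, 0 < K &
  forall n k t, (0 < n)%N -> 0 < t <= 1 -> 2 * M <= Num.sqrt n%:R ->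
  [/\ (n %| k.*2)%N -> fine (P (small_dft xi n k t)) <= K / Num.sqrt n%:R,
      ~~ (n %| k.*2)%N -> fine (P (small_dft xi n k t)) <= K / n%:R &
      ~~ (n %| k.*2)%N -> 6 * M * (gcdn k n)%:R <= n%:R * t ->
        fine (P (small_dft xi n k t)) <= K / n%:R ^+ 2 + K * t ^+ 2 / n%:R].
Proof.
pose A := 16 * gauss_const (p / 32) * M.
pose B := 64 * gauss_const (p / 2048) ^+ 2.
pose E := 8 * (512 / p) ^+ 2.
have A_gt0 : 0 < A by rewrite mulr_gt0// mulr_gt0// gauss_const_gt0// divr_gt0.
have B_ge0 : 0 <= B by rewrite mulr_ge0// sqr_ge0.
have E_ge0 : 0 <= E by rewrite mulr_ge0 ?sqr_ge0 ?ler0n.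
have BM2_ge : B <= B * M ^+ 2 by rewrite ler_peMr// expr_ge1// ltW.
exists (A + E + B * M ^+ 2) => [|n k t n_gt0 /andP[t_gt0 t_le1] M_le]; first lra.
have nR : 0 < n%:R :> R by rewrite ltr0n.
have n_ge1 : 1 <= n%:R :> R by rewrite ler1n.
have tM : t <= M by apply: le_trans M_ge1.
have expR_le : 4 * expR (- (p * n%:R / 512)) <= E / n%:R ^+ 2.
  have -> : E / n%:R ^+ 2 = 4 * (2 / (p * n%:R / 512) ^+ 2).
    by rewrite /E; field; rewrite !gt_eqF.
  by rewrite ler_wpM2l ?ler0n ?expRN_le_sqr ?divr_gt0 ?mulr_gt0 ?ltr0n.
split=> [nk|nk|nk gcd_le].
- apply: le_trans (small_dft_le_real n_gt0 nk tM (lexx M) M_le) _.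
  by rewrite ler_wpM2r ?invr_ge0 ?sqrtr_ge0// -/A; lra.
- apply: le_trans (small_dft_le_complex n_gt0 nk M_gt0 tM M_le (or_introl (lexx M))) _.
  rewrite -/B; apply: (@le_trans _ _ (E / n%:R + B * M ^+ 2 / n%:R)).
    rewrite lerD2r; apply: le_trans expR_le _; rewrite ler_wpM2l//.
    by rewrite lef_pV2 ?posrE ?exprn_gt0// expr2 ler_peMl// ltW.
  by rewrite -mulrDl ler_wpM2r ?invr_ge0 ?ltW//; lra.
- have t_le : 2 * t <= Num.sqrt n%:R by apply: le_trans M_le; rewrite ler_pM2l.
  apply: le_trans (small_dft_le_complex n_gt0 nk t_gt0 (lexx t) t_le (or_intror gcd_le)) _.
  rewrite -/B lerD//.
    by apply: le_trans expR_le _; rewrite ler_wpM2r ?invr_ge0 ?sqr_ge0//; lra.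
  by rewrite ler_wpM2r ?invr_ge0 ?(ltW nR)// ler_wpM2r ?sqr_ge0//; lra.
Qed.

End small_ball_bounds.

Section small_ball_sum.
Context {R : realType} {d : measure_display} {T : measurableType d}.
Variables (P : probability T R) (xi : nat -> {RV P >-> R}).
Hypothesis iid : iid_seq xi.

Lemma sum_small_order n Q : (0 < n)%N ->
  \sum_(k < n) (n <= Q * gcdn k n)%N%:R <= Q.+1%:R ^+ 2 :> R.
Proof.
move=> n_gt0; rewrite -natr_sum -natrX ler_nat.
apply: leq_trans (card_small_order Q n_gt0).
rewrite -sum1_card [leqRHS]big_mkcond/=.
by apply: leq_sum => k _; rewrite inE; case: (n <= _)%N.
Qed.

Lemma real_small_order n k : (0 < n)%N -> (n %| k.*2)%N -> (n <= 2 * gcdn k n)%N.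
Proof.
move=> n_gt0 nk; apply: dvdn_leq; first by rewrite muln_gt0 gcdn_gt0 n_gt0 orbT.
by rewrite muln_gcdr dvdn_gcd mul2n nk dvdn_mull.
Qed.

(* The frequencies of order at most [2] include the real eigenvalues, those of
   order at most [Q] are few, and for the others the bound at scale [t] applies. *)
Lemma small_dft_le_order p M : 0 < p -> 1 <= M -> separated xi p M ->
  exists2 K : R, 0 < K & forall n Q t (k : 'I_n), 0 < t <= 1 -> 2 * M <= Num.sqrt n%:R ->
  6 * M <= Q%:R * t ->
  fine (P (small_dft xi n k t)) <= (n <= 2 * gcdn k n)%N%:R * (K / Num.sqrt n%:R) +
    (n <= Q * gcdn k n)%N%:R * (K / n%:R) + (K / n%:R ^+ 2 + K * t ^+ 2 / n%:R).
Proof.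
move=> p_gt0 M_ge1 sep; have [K K_gt0 bounds] := small_dft_uniform iid p_gt0 M_ge1 sep.
exists K => // n Q t k t01 M_le Q_ge; have n_gt0 : (0 < n)%N by case: (n) k => // -[].
have nR : 0 < n%:R :> R by rewrite ltr0n.
have [real_le complex_le scale_le] := bounds n k t n_gt0 t01 M_le.
have real_ge0 : 0 <= K / Num.sqrt n%:R by rewrite divr_ge0 ?sqrtr_ge0 ?ltW.
have complex_ge0 : 0 <= K / n%:R by rewrite divr_ge0 ?ltW.
have scale_ge0 : 0 <= K / n%:R ^+ 2 + K * t ^+ 2 / n%:R.
  have Kt_ge0 : 0 <= K * t ^+ 2 by rewrite mulr_ge0 ?sqr_ge0 ?(ltW K_gt0).
  by rewrite addr_ge0// divr_ge0 ?sqr_ge0// ltW.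
have [nk|nk] := boolP (n %| k.*2)%N.
  rewrite (real_small_order n_gt0 nk) mul1r; apply: le_trans (real_le nk) _.
  by rewrite -addrA lerDl addr_ge0// mulr_ge0.
have [gcd_le|gcd_gt] := leP (6 * M * (gcdn k n)%:R) (n%:R * t).
  apply: le_trans (scale_le nk gcd_le) _.
  by rewrite lerDr addr_ge0// mulr_ge0.
have -> : (n <= Q * gcdn k n)%N.
  rewrite -(ler_nat R) natrM -(ler_pM2r (_ : 0 < t)); last by case/andP: t01.
  by rewrite (le_trans (ltW gcd_gt))// [leRHS]mulrAC ler_wpM2r.
rewrite mul1r; apply: le_trans (complex_le nk) _.
by rewrite addrAC lerDr addr_ge0// mulr_ge0.
Qed.

Lemma exists_order_cutoff (M t : R) : 0 < t <= 1 -> 1 <= M ->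
  exists2 Q, 6 * M <= Q%:R * t & Q.+1%:R <= 8 * M / t.
Proof.
move=> /andP[t_gt0 t_le1] M_ge1.
have /truncn_itv/andP[trunc_le lt_trunc] : 0 <= 6 * M / t.
  by rewrite divr_ge0 ?mulr_ge0 ?(ltW t_gt0)// (le_trans _ M_ge1).
exists (Num.truncn (6 * M / t)).+1; first by rewrite -ler_pdivrMr// ltW.
have : 1 <= M / t by rewrite ler_pdivlMr// mul1r; lra.
by rewrite -2!natr1; move: trunc_le; lra.
Qed.

Lemma sum_small_order_scale n Q (M t K : R) : (0 < n)%N -> 0 < M -> 0 < K -> 0 < t ->
  1 <= t ^+ 2 * Num.sqrt n%:R -> Q.+1%:R <= 8 * M / t ->
  \sum_(k < n) (n <= Q * gcdn k n)%N%:R * (K / n%:R) <= 64 * M ^+ 2 * K / Num.sqrt n%:R.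
Proof.
move=> n_gt0 M_gt0 K_gt0 t_gt0; set r := Num.sqrt n%:R => tn_ge Q_le.
have nR : 0 < n%:R :> R by rewrite ltr0n.
have r_gt0 : 0 < r by rewrite sqrtr_gt0.
have r2E : r ^+ 2 = n%:R by rewrite sqr_sqrtr.
apply: (@le_trans _ _ ((8 * M / t) ^+ 2 * (K / n%:R))).
  rewrite -mulr_suml ler_wpM2r ?divr_ge0 ?(ltW K_gt0)//.
  apply: le_trans (sum_small_order Q n_gt0) _.
  by rewrite ler_sqr ?nnegrE// divr_ge0 ?mulr_ge0 ?(ltW M_gt0) ?(ltW t_gt0).
have -> : (8 * M / t) ^+ 2 * (K / n%:R) = 64 * M ^+ 2 * K * (t ^+ 2 * n%:R)^-1.
  by field; rewrite !gt_eqF.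
apply: ler_wpM2l; first by rewrite !mulr_ge0 ?ler0n ?(ltW K_gt0) ?(ltW M_gt0).
rewrite lef_pV2 ?posrE// ?mulr_gt0 ?exprn_gt0// -r2E expr2 mulrA.
by rewrite ler_peMl// ltW.
Qed.

Lemma sum_small_dft : condH (xi 0%N) -> exists2 D : R, 0 < D &
  exists N : nat, forall n t, (N <= n)%N -> 0 < t <= 1 -> 1 <= t ^+ 2 * Num.sqrt n%:R ->
  \sum_(k < n) fine (P (small_dft xi n k t)) <= D * ((Num.sqrt n%:R)^-1 + t ^+ 2).
Proof.
move=> /(condH_separated iid)[p [M [p_gt0 M_ge1 sep]]].
have [K K_gt0 bound] := small_dft_le_order p_gt0 M_ge1 sep.
exists (9 * K + 100 * M ^+ 2 * K + K).
  have : 0 < M ^+ 2 * K by rewrite mulr_gt0// exprn_gt0//; lra.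
  lra.
have [N sqrt_ge] := sqrt_natr_eventually (2 * M).
exists N.+1 => n t lt_Nn /[dup] t01 /andP[t_gt0 t_le1] tn_ge.
have n_gt0 : (0 < n)%N by exact: leq_ltn_trans lt_Nn.
have M_gt0 : 0 < M by lra.
have M_le := sqrt_ge n (ltnW lt_Nn).
have [Q Q_ge Q_le] := exists_order_cutoff t01 M_ge1.
apply: le_trans (ler_sum _ (fun k _ => bound n Q t k t01 M_le Q_ge)) _.
rewrite !big_split/= !sumr_const card_ord.
have order_le := sum_small_order_scale n_gt0 M_gt0 K_gt0 t_gt0 tn_ge Q_le.
set r := Num.sqrt n%:R in M_le order_le *.
have r_gt0 : 0 < r by rewrite sqrtr_gt0 ltr0n.
have r2E : r ^+ 2 = n%:R by rewrite sqr_sqrtr.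
have nR : 0 < n%:R :> R by rewrite ltr0n.
have nV_le : n%:R^-1 <= r^-1 by rewrite lef_pV2 ?posrE// -r2E expr2 ler_peMl; lra.
have real_le : \sum_(k < n) (n <= 2 * gcdn k n)%N%:R * (K / r) <= 9 * (K / r).
  rewrite -mulr_suml ler_wpM2r ?divr_ge0 ?(ltW K_gt0) ?(ltW r_gt0)//.
  by apply: le_trans (sum_small_order 2 n_gt0) _; rewrite -natrX.
have rest_eq : (K / n%:R ^+ 2) *+ n + (K * t ^+ 2 / n%:R) *+ n = K * n%:R^-1 + K * t ^+ 2.
  by rewrite -[X in X + _]mulr_natr -[X in _ + X]mulr_natr; field; rewrite gt_eqF.
have := ler_wpM2l (ltW K_gt0) nV_le.
have M2K_ge0 : 0 <= M ^+ 2 * K by rewrite mulr_ge0 ?sqr_ge0 ?(ltW K_gt0).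
have : 0 <= M ^+ 2 * K * t ^+ 2 by rewrite mulr_ge0 ?sqr_ge0.
have : 0 <= K * t ^+ 2 by rewrite mulr_ge0 ?sqr_ge0 ?(ltW K_gt0).
have : 0 <= M ^+ 2 * K * r^-1 by rewrite mulr_ge0 ?invr_ge0 ?(ltW r_gt0).
rewrite rest_eq; lra.
Qed.

End small_ball_sum.

Section exponential_moments.
Context {R : realType} {d : measure_display} {T : measurableType d}.
Variable P : probability T R.

Lemma expectation_expR_le (F X H : T -> R) : measurable_fun setT F ->
  P.-integrable setT (EFin \o X) -> \int[P]_w X w = 0 -> P.-integrable setT (EFin \o H) ->
  (forall w, expR (F w) <= 1 + X w + H w) ->
  (\int[P]_w (expR (F w))%:E <= (expR (\int[P]_w H w))%:E)%E.
Proof.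
move=> mF iX EX0 iH expR_le.
have i1 : P.-integrable setT (EFin \o (fun=> 1 : R)) by exact: finite_measure_integrable_cst.
have i1X : P.-integrable setT (EFin \o (fun w => 1 + X w)).
  exact: (integrableD measurableT i1 iX).
have i1XH : P.-integrable setT (EFin \o (fun w => 1 + X w + H w)).
  exact: (integrableD measurableT i1X iH).
apply: (@le_trans _ _ (\int[P]_w (1 + X w + H w)%:E)%E).
  apply: ge0_le_integral => //.
  - by apply/measurable_EFinP; exact: measurableT_comp mF.
  - exact: measurable_int i1XH.
  - by move=> w _; rewrite lee_fin.
rewrite -[X in (X <= _)%E]fineK; last exact: (integrable_fin_num measurableT i1XH).
rewrite -/(Rintegral P setT _) RintegralD// RintegralD// Rintegral_probability_cst EX0 addr0.
by rewrite lee_fin expR_ge1Dx.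
Qed.

Variable xi : nat -> {RV P >-> R}.
Hypothesis iid : iid_seq xi.

Lemma expectation_expR_sum_le n (f : nat -> R -> R) (b : R) :
  (forall j, measurable_fun setT (f j)) ->
  (forall j, (\int[P]_w (expR (f j (xi 0%N w)))%:E <= (expR b)%:E)%E) ->
  (\int[P]_w (expR (\sum_(j < n) f j (xi j w)))%:E <= (expR (n%:R * b))%:E)%E.
Proof.
move=> mf f_le.
elim: n => [|n ih].
  under eq_integral do rewrite big_ord0 expR0.
  by rewrite integral_cst// [X in (_ * X)%E](probability_setT P) mule1 mul0r expR0.
under eq_integral do rewrite big_ord_recr/= expRD.
pose S w := \sum_(j < n) f j (xi j w); have mS : measurable_fun setT S.
  exact: (measurable_iid_sum xi n mf).
have mlast := measurableT_comp (mf n) (measurable_funPT (xi n)).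
rewrite (@ge0_integral_indepM _ _ _ P (fun w => expR (S w)) (fun w => expR (f n (xi n w))))//=.
- rewrite -natr1 mulrDl mul1r expRD EFinM; apply: lee_pmul.
  + by apply: integral_ge0 => w _; rewrite lee_fin expR_ge0.
  + by apply: integral_ge0 => w _; rewrite lee_fin expR_ge0.
  + exact: ih.
  + have mexpE : measurable_fun setT (fun x => (expR (f n x))%:E).
      by apply/measurable_EFinP; exact: measurableT_comp (@measurable_expR R) (mf n).
    by rewrite (integral_iid iid n mexpE).
- exact: measurableT_comp (@measurable_expR R) mS.
- exact: measurableT_comp (@measurable_expR R) mlast.
- exact: (indep_rv_comp (@measurable_expR R) (@measurable_expR R) (indep_iid_sum iid n mf)).
Qed.

Lemma chernoff_iid_sum n (f : nat -> R -> R) (b a : R) :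
  (forall j, measurable_fun setT (f j)) ->
  (forall j, (\int[P]_w (expR (f j (xi 0%N w)))%:E <= (expR b)%:E)%E) ->
  (P [set w | (a <= \sum_(j < n) f j (xi j w))%R] <= (expR (n%:R * b - a))%:E)%E.
Proof.
move=> mf f_le.
pose S : {RV P >-> R} := mfun_Sub (mem_set (measurable_iid_sum xi n mf)).
apply: le_trans (chernoff S a ltr01) _.
rewrite mul1r expRD EFinM lee_wpmul2r ?lee_fin ?expR_ge0// /mmt_gen_fun unlock.
apply: le_trans (expectation_expR_sum_le n mf f_le).
by under eq_integral do rewrite /= mulr1.
Qed.

End exponential_moments.

Section large_dft_tail.
Context {R : realType} {d : measure_display} {T : measurableType d}.
Variables (P : probability T R) (xi : nat -> {RV P >-> R}) (tau H : R -> R) (t : R).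
Hypothesis iid : iid_seq xi.
Hypothesis mtau : measurable_fun setT tau.
Hypothesis t_gt0 : 0 < t.
Hypothesis ixi : P.-integrable setT (EFin \o xi 0%N).
Hypothesis Exi0 : \int[P]_w xi 0%N w = 0.
Hypothesis iH : P.-integrable setT (EFin \o (fun w => H (xi 0%N w))).
(* The linear term in [x] rather than [tau x] lets truncations [tau] use the
   centering of the untruncated variables. *)
Hypothesis expR_le : forall c x, `|c| <= 1 ->
  expR (t * (c * tau x)) <= 1 + t * (c * x) + H x.
Implicit Types (n k : nat) (a : R) (c : nat -> R).

Let X j w : R := tau (xi j w).
Let eta : R := \int[P]_w H (xi 0%N w).

Let mX j : measurable_fun setT (X j).
Proof. exact: measurableT_comp mtau (measurable_funPT (xi j)). Qed.

Lemma weighted_sum_tail n c a : (forall j, `|c j| <= 1) ->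
  (P [set w | (a <= \sum_(j < n) c j * X j w)%R] <= (expR (n%:R * eta - t * a))%:E)%E.
Proof.
move=> c_le1; pose f j x := t * (c j * tau x).
have mf j : measurable_fun setT (f j).
  by apply: measurable_funM => //; exact: measurable_funM.
rewrite (_ : [set w | _] = [set w | t * a <= \sum_(j < n) f j (xi j w)]).
  apply: (chernoff_iid_sum iid n _ mf) => j.
  apply: (expectation_expR_le (X := fun w => t * (c j * xi 0%N w)) _ _ _ iH).
  - exact: measurableT_comp (mf j) (measurable_funPT (xi 0%N)).
  - under eq_fun do rewrite mulrA.
    exact: (integrableZl measurableT (t * c j) ixi).
  - under eq_Rintegral do rewrite mulrA.
    by rewrite RintegralZl// Exi0 mulr0.
  - by move=> w; exact: expR_le.
by apply/seteqP; split=> w /=; rewrite /f -mulr_sumr ler_pM2l.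
Qed.

Lemma abs_weighted_sum_tail n c a : (forall j, `|c j| <= 1) ->
  (P [set w | (a <= `|\sum_(j < n) c j * X j w|)%R] <=
   (2 * expR (n%:R * eta - t * a))%:E)%E.
Proof.
move=> c_le1; have mS c' : measurable_fun setT (fun w => \sum_(j < n) c' j * X j w).
  by apply: measurable_sum => j; exact: measurable_funM.
have mupper c' : measurable [set w | a <= \sum_(j < n) c' j * X j w].
  by apply: measurable_setle => //; exact: mS.
rewrite (_ : [set w | _] = [set w | a <= \sum_(j < n) c j * X j w] `|`
    [set w | a <= \sum_(j < n) - c j * X j w]); last first.
  apply/seteqP; split=> w /=; rewrite ler_normr -sumrN.
    by under [X in _ || (_ <= X)]eq_bigr do rewrite -mulNr; move/orP.
  by under [X in _ || (_ <= X)]eq_bigr do rewrite -mulNr; move/orP.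
apply: le_trans (measureU2 _ (mupper c) (mupper (fun j => - c j))) _.
rewrite mulr_natl mulr2n EFinD; apply: leeD; first exact: weighted_sum_tail.
by apply: (@weighted_sum_tail n (fun j => - c j) a) => j; rewrite normrN.
Qed.

Lemma large_dft_le n k a :
  (P (large_dft X n k a) <= (4 * expR (n%:R * eta - t * a))%:E)%E.
Proof.
have mre : measurable [set w | a <= `|dft_re n k (X ^~ w)|].
  by apply: measurable_setle => //; apply: measurableT_comp => //; exact: measurable_dft_re.
have mim : measurable [set w | a <= `|dft_im n k (X ^~ w)|].
  by apply: measurable_setle => //; apply: measurableT_comp => //; exact: measurable_dft_im.
apply: le_trans (measureU2 _ mre mim) _.
have -> : 4 * expR (n%:R * eta - t * a) =
  2 * expR (n%:R * eta - t * a) + 2 * expR (n%:R * eta - t * a) by ring.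
rewrite EFinD; apply: leeD.
  rewrite /dft_re; under eq_set do under eq_bigr do rewrite mulrC.
  by apply: (@abs_weighted_sum_tail n (fun j => cos (theta n k * j%:R))) => j; exact: cos_max.
rewrite /dft_im; under eq_set do under eq_bigr do rewrite mulrC.
by apply: (@abs_weighted_sum_tail n (fun j => sin (theta n k * j%:R))) => j; exact: sin_max.
Qed.

Lemma exists_large_dft_le n a : (P [set w | exists k : 'I_n, large_dft X n k a w] <=
  (n%:R * (4 * expR (n%:R * eta - t * a)))%:E)%E.
Proof.
apply: le_trans (probability_exists_ord_le P n (A := fun k => large_dft X n k a) _) _.
  by move=> k; exact: measurable_large_dft.
apply: (@le_trans _ _ (\sum_(k < n) (4 * expR (n%:R * eta - t * a))%:E)%E).
  by apply: lee_sum => k _; exact: large_dft_le.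
by rewrite sumEFin sumr_const card_ord [X in (_ <= X%:E)%E]mulr_natl.
Qed.

End large_dft_tail.

Section truncation.
Context {R : realType}.
Implicit Types (r c x : R) (n k : nat).

Definition truncate r x : R := if `|x| <= r then x else 0.

Lemma measurable_truncate r : measurable_fun setT (truncate r).
Proof. by apply: measurable_fun_ifT => //; exact: measurable_fun_ler. Qed.

Lemma truncate_dist r x : 0 < r -> `|x - truncate r x| <= x ^+ 2 / r.
Proof.
move=> r_gt0; rewrite /truncate; have [_|x_gt] := leP `|x| r.
  by rewrite subrr normr0 divr_ge0 ?sqr_ge0 ?(ltW r_gt0).
rewrite subr0 ler_pdivlMr// -[x ^+ 2]real_normK ?num_real// expr2.
by rewrite ler_wpM2l// ltW.
Qed.

Lemma expR_truncate_le r c x : 0 < r -> `|c| <= 1 ->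
  expR (r^-1 * (c * truncate r x)) <=
  1 + r^-1 * (c * x) + r ^- 2 * ((1 + expR 1) * x ^+ 2).
Proof.
move=> r_gt0 c_le1; set z := r^-1 * `|x|.
have z_ge0 : 0 <= z by rewrite mulr_ge0 ?invr_ge0 ?(ltW r_gt0).
have -> : r ^- 2 * ((1 + expR 1) * x ^+ 2) = (1 + expR 1) * z ^+ 2.
  by rewrite /z exprMn exprVn real_normK ?num_real// mulrCA.
have y_le : `|r^-1 * (c * x)| <= z.
  rewrite !normrM (@gtr0_norm _ r^-1) ?invr_gt0// ler_wpM2l ?invr_ge0 ?(ltW r_gt0)//.
  by rewrite ler_piMl.
have e_gt0 := expR_gt0 (1 : R).
rewrite /truncate; have [x_le|x_gt] := leP `|x| r.
  have z_le1 : z <= 1 by rewrite /z mulrC ler_pdivrMr// mul1r.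
  apply: le_trans (expR_le_quadratic _) _; rewrite lerD2l.
  set y := r^-1 * (c * x) in y_le *.
  have y2_le : y ^+ 2 <= z ^+ 2 by rewrite -[leLHS]real_normK ?num_real// ler_sqr.
  have expR_y_le : expR `|y| <= expR 1 by rewrite ler_expR (le_trans y_le).
  apply: (@le_trans _ _ (z ^+ 2 * expR 1)); first by rewrite ler_pM ?sqr_ge0.
  by rewrite mulrC ler_wpM2r ?sqr_ge0//; lra.
have z_ge1 : 1 <= z by rewrite /z mulrC ler_pdivlMr// mul1r ltW.
rewrite !mulr0 expR0; move: y_le; rewrite ler_norml => /andP[y_ge _].
have : z <= z ^+ 2 by rewrite expr2 ler_peMl.
have : 0 <= expR 1 * z ^+ 2 by rewrite mulr_ge0 ?expR_ge0 ?sqr_ge0.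
lra.
Qed.

Lemma norm_sum_le_truncate n (g x : nat -> R) r : 0 < r -> (forall j, `|g j| <= 1) ->
  `|\sum_(j < n) x j * g j| <=
  `|\sum_(j < n) truncate r (x j) * g j| + (\sum_(j < n) x j ^+ 2) / r.
Proof.
move=> r_gt0 g_le1.
have -> : \sum_(j < n) x j * g j = \sum_(j < n) truncate r (x j) * g j +
    \sum_(j < n) (x j - truncate r (x j)) * g j.
  by rewrite -big_split/=; apply: eq_bigr => j _; ring.
apply: le_trans (ler_normD _ _) _; rewrite lerD2l mulr_suml.
apply: le_trans (ler_norm_sum _ _ _) _; apply: ler_sum => j _.
by rewrite normrM (le_trans _ (truncate_dist (x j) r_gt0))// ler_piMr.
Qed.

End truncation.

(* The factor [x ^ 2] of the quadratic bound is absorbed by [expR (a * `|x|)]. *)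
Lemma expR_le_exponential_moment {R : realType} (a t c x : R) : 0 < t <= a -> `|c| <= 1 ->
  expR (t * (c * x)) <= 1 + t * (c * x) +
    t ^+ 2 * (2 / a ^+ 2 * (expR (2 * a * x) + expR (- (2 * a) * x))).
Proof.
move=> /andP[t_gt0 t_le] c_le1; have a_gt0 : 0 < a by exact: lt_le_trans t_le.
apply: le_trans (expR_le_quadratic _) _; rewrite lerD2l exprMn -[leLHS]mulrA ler_wpM2l ?sqr_ge0//.
set E := expR (a * `|x|).
have expR_le : expR `|t * (c * x)| <= E.
  rewrite ler_expR !normrM (gtr0_norm t_gt0) ler_pM ?mulr_ge0 ?(ltW t_gt0)//.
  by rewrite ler_piMl.
have x2_le : x ^+ 2 <= 2 / a ^+ 2 * E.
  rewrite mulrAC ler_pdivlMr ?exprn_gt0//.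
  have : 0 <= a * `|x| by rewrite mulr_ge0// ltW.
  by move=> /sqr_le_expR; rewrite exprMn real_normK ?num_real// mulrC.
have E2_le : E * E <= expR (2 * a * x) + expR (- (2 * a) * x).
  have -> : E * E = expR (2 * a * `|x|) by rewrite -expRD; congr expR; ring.
  have [x_ge0|x_lt0] := leP 0 x; first by rewrite ger0_norm// lerDl expR_ge0.
  by rewrite ltr0_norm// mulNr -mulrN lerDr expR_ge0.
apply: (@le_trans _ _ (x ^+ 2 * E)).
  apply: ler_pM => //; rewrite ?sqr_ge0 ?expR_ge0// exprMn ler_piMl ?sqr_ge0//.
  by rewrite -[leLHS]real_normK ?num_real// expr_le1.
apply: (@le_trans _ _ (2 / a ^+ 2 * E * E)); first by rewrite ler_wpM2r// expR_ge0.
by rewrite -mulrA ler_wpM2l// divr_ge0// sqr_ge0.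
Qed.

Lemma kappa_circulant_tail {R : realType} {d : measure_display} {T : measurableType d}
    (P : probability T R) (X : nat -> T -> R) n (t a c b s : R) :
  (forall j, measurable_fun setT (X j)) -> (0 < n)%N -> 0 < t -> 0 <= a -> 2 * a <= c * t ->
  (P [set w | exists k : 'I_n, large_dft X n k a w] <= b%:E)%E ->
  \sum_(k < n) fine (P (small_dft X n k t)) <= s ->
  ((1 - (b + s))%:E <= P [set w | (kappa (circulant n (X ^~ w)) <= c%:E)%E])%E.
Proof.
move=> mX n_gt0 t_gt0 a_ge0 a_le large_le small_le.
have c_ge0 : 0 <= c by rewrite -(pmulr_lge0 _ t_gt0) (le_trans _ a_le)// mulr_ge0.
set large := [set w | _] in large_le.
pose small := [set w | exists k : 'I_n, small_dft X n k t w].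
have mlarge : measurable large by exact: measurable_exists_large_dft.
have mA k : measurable (small_dft X n k t) by exact: measurable_small_dft.
have msmall : measurable small by exact: (measurable_exists_ord n mA).
apply: (@le_trans _ _ (P (~` (large `|` small)))); last first.
  apply: le_measure; rewrite ?inE; [by apply: measurableC; exact: measurableU| |].
    exact: measurable_kappa_circulant.
  move=> w /not_orP[not_large not_small].
  apply: (kappa_circulant_le_bounds n_gt0 t_gt0 a_le) => k.
    have : ~ small_dft X n k t w by move=> ?; apply: not_small; exists k.
    by move=> /not_andP[/negP|/negP]; rewrite -ltNge; [left|right].
  have : ~ large_dft X n k a w by move=> ?; apply: not_large; exists k.
  by move=> /not_orP[/negP + /negP]; rewrite -!ltNge => /ltW + /ltW.
rewrite probability_setC; last exact: measurableU.
have union_le : (P (large `|` small) <= (b + s)%:E)%E.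
  apply: le_trans (measureU2 _ mlarge msmall) _; rewrite EFinD leeD//.
  apply: le_trans (probability_exists_ord_le P n mA) _.
  apply: le_trans (_ : _ <= (\sum_(k < n) fine (P (small_dft X n k t)))%:E)%E _; last first.
    by rewrite lee_fin.
  by rewrite -sumEFin; apply: lee_sum => k _; rewrite fineK// fin_num_measure.
by rewrite EFinB leeB.
Qed.

Section condition_number.
Context {R : realType} {d : measure_display} {T : measurableType d}.
Variables (P : probability T R) (xi : nat -> {RV P >-> R}).
Hypothesis iid : iid_seq xi.

Definition large_dft_rate A B (L y : nat -> R) :=
  exists N : nat, forall n, (N <= n)%N -> [/\ 0 <= L n, (Num.sqrt n%:R)^-1 <= y n &
    (P [set w | exists k : 'I_n, large_dft xi n k (A * (Num.sqrt n%:R * L n)) w] <=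
     (B * y n)%:E)%E].

Lemma kappa_circulant_rate A B L y : condH (xi 0%N) -> 0 < A -> 0 < B ->
  large_dft_rate A B L y -> exists C0 C1 : R, [/\ 0 < C0, 0 < C1 &
  forall eps rho : R, 0 < eps -> 0 < rho < 1 / 4 -> exists N : nat, forall n, (N <= n)%N ->
  ((1 - C1 * ((eps ^+ 2 + eps) * n%:R `^ (- (2 * rho)) + y n))%:E <=
   P [set w | (kappa (circulant n (fun k => xi k w)) <=
     (C0 / eps * n%:R `^ (rho + 1 / 2) * L n)%:E)%E])%E].
Proof.
move=> /(sum_small_dft iid)[D D_gt0 [N1 small_le]] A_gt0 B_gt0 [N2 large_le].
exists (2 * A), (B + D); split=> [||eps rho eps_gt0 rho01]; [lra|lra|].
have [N3 scale] := scale_eventually eps_gt0 rho01.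
exists (maxn 1 (maxn N1 (maxn N2 N3))) => n; rewrite !geq_max => /and4P[n_gt0 N1n N2n N3n].
have [L_ge0 y_ge large_le_n] := large_le n N2n.
have [t01 tn_ge] := scale n N3n n_gt0; set t := eps * _ in t01 tn_ge.
have /andP[t_gt0 _] := t01; set Z := (eps ^+ 2 + eps) * _.
have Z_ge0 : 0 <= Z by rewrite mulr_ge0 ?powR_ge0// addr_ge0 ?sqr_ge0 ?(ltW eps_gt0).
have t2_le : t ^+ 2 <= Z.
  rewrite exprMn -[(n%:R `^ _) ^+ 2]powR_mulrn ?powR_ge0// -powRrM.
  by rewrite mulNr [rho * 2]mulrC ler_wpM2r ?powR_ge0// lerDl ltW.
apply: le_trans (kappa_circulant_tail _ n_gt0 t_gt0 _ _ large_le_n (small_le n t N1n t01 tn_ge)).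
- rewrite lee_fin lerB//; have := ler_wpM2l (ltW D_gt0) y_ge.
  have := ler_wpM2l (ltW D_gt0) t2_le; have := mulr_ge0 (ltW B_gt0) Z_ge0; lra.
- by move=> j; exact: measurable_funPT.
- exact: (mulr_ge0 (ltW A_gt0) (mulr_ge0 (sqrtr_ge0 _) L_ge0)).
- by rewrite scaled_threshold// [leLHS]mulrA.
Qed.

Lemma exists_large_dft_exp (t0 : R) :
  P.-integrable setT (EFin \o xi 0%N) -> ('E_P[xi 0%N] = 0)%E -> 0 < t0 ->
  (forall t : R, - t0 < t < t0 ->
    P.-integrable setT (EFin \o (fun w => expR (t * xi 0%N w)))) ->
  exists2 A : R, 0 < A &
  large_dft_rate A 4 (fun n => Num.sqrt (ln n%:R)) (fun n => n%:R `^ (- (1 / 2))).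
Proof.
move=> ixi Exi t0_gt0 mgf; pose a := t0 / 4; have a_gt0 : 0 < a by rewrite divr_gt0.
have Exi0 : \int[P]_w xi 0%N w = 0 by move: Exi; rewrite unlock /Rintegral => ->.
pose h x := 2 / a ^+ 2 * (expR (2 * a * x) + expR (- (2 * a) * x)).
have ih : P.-integrable setT (EFin \o (fun w => h (xi 0%N w))).
  have upper : - t0 < 2 * a < t0 by rewrite /a; lra.
  have lower : - t0 < - (2 * a) < t0 by rewrite /a; lra.
  exact: (integrableZl measurableT (2 / a ^+ 2)
    (integrableD measurableT (mgf _ upper) (mgf _ lower))).
pose eta := \int[P]_w h (xi 0%N w).
have eta_ge0 : 0 <= eta.
  apply: Rintegral_ge0 => w _.
  by rewrite mulr_ge0 ?divr_ge0 ?sqr_ge0// addr_ge0 ?expR_ge0.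
have [N ratio_le] := sqrt_ln_ratio_eventually a_gt0.
exists (eta + 2); first lra; exists (maxn 2 N) => n; rewrite geq_max => /andP[n_ge2 Nn].
have nR : 0 < n%:R :> R by rewrite ltr0n ltnW.
have := ratio_le n n_ge2 Nn; set r := Num.sqrt n%:R; set q := Num.sqrt (ln n%:R) => qr01.
have r_gt0 : 0 < r by rewrite sqrtr_gt0.
have r2E : r ^+ 2 = n%:R by rewrite sqr_sqrtr// ltW.
have q2E : q ^+ 2 = ln n%:R by rewrite sqr_sqrtr// ln_ge0// ler1n ltnW.
have [qr_gt0 _] := andP qr01.
split; [exact: sqrtr_ge0|by rewrite powR_neg_half|].
have iH : P.-integrable setT (EFin \o (fun w => (q / r) ^+ 2 * h (xi 0%N w))).
  exact: (integrableZl measurableT ((q / r) ^+ 2) ih).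
have expR_le c x : `|c| <= 1 ->
    expR (q / r * (c * id x)) <= 1 + q / r * (c * x) + (q / r) ^+ 2 * h x.
  exact: expR_le_exponential_moment.
apply: le_trans (exists_large_dft_le iid (tau := id) _ qr_gt0 ixi Exi0 iH expR_le n _) _ => //.
rewrite lee_fin RintegralZl// -/eta.
have -> : n%:R * ((q / r) ^+ 2 * eta) - q / r * ((eta + 2) * (r * q)) = - (2 * ln n%:R).
  by rewrite -q2E -r2E; field; rewrite gt_eqF.
by rewrite mulrCA ler_pM2l// powR_neg_half mul_expRN2_ln_le// ltnW.
Qed.

Lemma sum_sqr_tail n (L : R) : 0 < L ->
  P.-integrable setT (EFin \o (fun w => xi 0%N w ^+ 2)) ->
  (P [set w | (L <= \sum_(j < n) xi j w ^+ 2)%R] <=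
   (n%:R * \int[P]_w (xi 0%N w ^+ 2) / L)%:E)%E.
Proof.
move=> L_gt0 i2.
have msqr (j : nat) : measurable_fun setT (fun x : R => x ^+ 2) by exact: measurable_funX.
have mS := measurable_iid_sum xi n msqr.
pose S : {RV P >-> R} := mfun_Sub (mem_set mS).
have S_ge0 w : 0 <= \sum_(j < n) xi j w ^+ 2 by apply: sumr_ge0 => j _; exact: sqr_ge0.
have markov_le := markov S L_gt0 (@measurable_id _ _ setT)
  (fun r r_ge0 => r_ge0) (fun x y _ _ xy => xy).
rewrite (_ : [set w | _] = [set w | (L%:E <= `|(S w)%:E|)%E]); last first.
  by apply: eq_set => w; rewrite /= lee_fin ger0_norm.
rewrite EFinM lee_pdivlMr// muleC; apply: (le_trans markov_le).
rewrite unlock; under eq_integral do rewrite /= ger0_norm// -sumEFin.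
rewrite ge0_integral_sum//.
- rewrite (eq_bigr (fun=> (\int[P]_w (xi 0%N w ^+ 2))%:E)) => [|j _].
    by rewrite sumEFin sumr_const card_ord mulr_natl.
  have msqrE : measurable_fun setT (fun x : R => (x ^+ 2)%:E).
    by apply/measurable_EFinP; exact: msqr.
  by rewrite (integral_iid iid j msqrE) /Rintegral fineK// (integrable_fin_num measurableT i2).
- by move=> j; apply/measurable_EFinP; exact: measurable_funX.
- by move=> j w _; rewrite lee_fin sqr_ge0.
Qed.

Lemma exists_large_dft_truncate n (r a L : R) : 0 < r ->
  [set w | exists k : 'I_n, large_dft xi n k (a + L / r) w] `<=`
  [set w | exists k : 'I_n, large_dft (fun j w => truncate r (xi j w)) n k a w] `|`
  [set w | L <= \sum_(j < n) xi j w ^+ 2].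
Proof.
move=> r_gt0 w [k large]; have [L_le|lt_L] := leP L (\sum_(j < n) xi j w ^+ 2); first by right.
left; exists k; have : (\sum_(j < n) xi j w ^+ 2) / r <= L / r by rewrite ler_pM2r ?invr_gt0 ?ltW.
have /= := norm_sum_le_truncate n (fun j => xi j w) r_gt0 (fun j => cos_max (theta n k * j%:R)).
have /= := norm_sum_le_truncate n (fun j => xi j w) r_gt0 (fun j => sin_max (theta n k * j%:R)).
by case: large => large; [left|right]; move: large; rewrite /dft_re /dft_im; lra.
Qed.

Lemma exists_large_dft_sqr_le n (r a L : R) : 0 < r -> 0 < L ->
  P.-integrable setT (EFin \o xi 0%N) -> ('E_P[xi 0%N] = 0)%E ->
  P.-integrable setT (EFin \o (fun w => xi 0%N w ^+ 2)) ->
  (P [set w | exists k : 'I_n, large_dft xi n k (a + L / r) w] <=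
   (n%:R * (4 * expR (n%:R * (r ^- 2 * ((1 + expR 1) * \int[P]_w (xi 0%N w ^+ 2))) - r^-1 * a)) +
    n%:R * \int[P]_w (xi 0%N w ^+ 2) / L)%:E)%E.
Proof.
move=> r_gt0 L_gt0 ixi Exi i2.
have Exi0 : \int[P]_w xi 0%N w = 0 by move: Exi; rewrite unlock /Rintegral => ->.
have i2e : P.-integrable setT (EFin \o (fun w => (1 + expR 1) * xi 0%N w ^+ 2)).
  exact: (integrableZl measurableT (1 + expR 1) i2).
have iH : P.-integrable setT (EFin \o (fun w => r ^- 2 * ((1 + expR 1) * xi 0%N w ^+ 2))).
  exact: (integrableZl measurableT (r ^- 2) i2e).
have rV_gt0 : 0 < r^-1 by rewrite invr_gt0.
have mtau := measurable_truncate r.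
have large_le := exists_large_dft_le iid mtau rV_gt0 ixi Exi0 iH
  (fun c x => expR_truncate_le x r_gt0) n a.
rewrite RintegralZl// RintegralZl// in large_le.
have mtrunc : measurable [set w | exists k : 'I_n,
    large_dft (fun j w => truncate r (xi j w)) n k a w].
  apply: measurable_exists_large_dft => j.
  exact: measurableT_comp mtau (measurable_funPT (xi j)).
have msqr : measurable [set w | L <= \sum_(j < n) xi j w ^+ 2].
  apply: measurable_setle => //; apply: measurable_sum => j.
  exact: measurable_funX (measurable_funPT (xi j)).
apply: (@le_trans _ _ (P ([set w | exists k : 'I_n,
    large_dft (fun j w => truncate r (xi j w)) n k a w] `|`
    [set w | L <= \sum_(j < n) xi j w ^+ 2]))).
  apply: le_measure; rewrite ?inE; [|exact: measurableU|exact: exists_large_dft_truncate].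
  by apply: measurable_exists_large_dft => j; exact: measurable_funPT.
apply: le_trans (measureU2 _ mtrunc msqr) _.
by rewrite EFinD; apply: leeD; [exact: large_le|exact: sum_sqr_tail].
Qed.

Lemma exists_large_dft_sqr :
  P.-integrable setT (EFin \o xi 0%N) -> ('E_P[xi 0%N] = 0)%E ->
  P.-integrable setT (EFin \o (fun w => xi 0%N w ^+ 2)) ->
  exists2 B : R, 0 < B &
  large_dft_rate 3 B (fun n => ln n%:R) (fun n => (Num.sqrt (ln n%:R))^-1).
Proof.
move=> ixi Exi i2; pose var := \int[P]_w (xi 0%N w ^+ 2).
have var_ge0 : 0 <= var by apply: Rintegral_ge0 => w _; exact: sqr_ge0.
pose eta := (1 + expR 1) * var; have e_gt0 := expR_gt0 eta.
exists (4 * expR eta + var); first by lra.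
have [N ln_ge1] := @ln_natr_ge1_eventually R.
exists (maxn 1 N) => n; rewrite geq_max => /andP[n_gt0 /ln_ge1].
have nR : 0 < n%:R :> R by rewrite ltr0n.
set l := ln n%:R => l_ge1; set r := Num.sqrt n%:R.
have r_gt0 : 0 < r by rewrite sqrtr_gt0.
have r2E : r ^+ 2 = n%:R by rewrite sqr_sqrtr// ltW.
have rV_le : r^-1 <= (Num.sqrt l)^-1.
  rewrite lef_pV2 ?posrE ?sqrtr_gt0 ?ler_wsqrtr//; last lra.
  by rewrite ltW// ln_sublinear.
have lV_le : l^-1 <= (Num.sqrt l)^-1.
  rewrite lef_pV2 ?posrE ?sqrtr_gt0; [|lra..].
  by rewrite -[leRHS]sqr_sqrtr ?expr2 ?ler_peMl ?sqrtr_ge0// -?[leLHS]sqrtr1 ?ler_wsqrtr//; lra.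
split; [lra|exact: rV_le|].
have -> : 3 * (r * l) = 2 * (r * l) + n%:R * l / r by rewrite -r2E; field; rewrite gt_eqF.
have nl_gt0 : 0 < n%:R * l by rewrite mulr_gt0//; lra.
apply: le_trans (exists_large_dft_sqr_le n _ r_gt0 nl_gt0 ixi Exi i2) _.
rewrite lee_fin -/var -/eta.
have -> : n%:R * (r ^- 2 * eta) - r^-1 * (2 * (r * l)) = eta - 2 * l.
  by rewrite -r2E; field; rewrite gt_eqF.
have -> : n%:R * var / (n%:R * l) = var * l^-1 by field; rewrite !gt_eqF//; lra.
rewrite [leRHS]mulrDl expRD.
have := ler_wpM2l var_ge0 lV_le.
have := ler_wpM2l (ltW e_gt0) (le_trans (mul_expRN2_ln_le n_gt0) rV_le).
by rewrite -/l; lra.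
Qed.

End condition_number.

Theorem mainTheorem6 (R : realType) (d : measure_display) (T : measurableType d)
  (P : probability T R) (xi : nat -> {RV P >-> R}) :
  iid_seq xi -> condH (xi 0%N) ->
  (* Part (1) *)
  ((P.-integrable setT (EFin \o xi 0%N) /\ ('E_P[xi 0%N] = 0)%E /\
    P.-integrable setT (EFin \o (fun w => xi 0%N w ^+ 2)) /\ (0 < variance P (xi 0%N))%E /\
    (exists t0 : R, 0 < t0 /\ forall t : R, -t0 < t < t0 ->
        P.-integrable setT (EFin \o (fun w => expR (t * xi 0%N w))))) ->
   exists (C0 C1 : R), 0 < C0 /\ 0 < C1 /\
   exists delta : nat -> R, delta @ \oo --> 0 /\
   forall (eps rho : R), 0 < eps -> 0 < rho < 1 / 4 ->
   exists N : nat, forall n : nat, (N <= n)%N ->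
     (P [set w | (kappa (circulant n (fun k => xi k w))
                  <= (C0 / eps * n%:R `^ (rho + 1 / 2) * Num.sqrt (ln n%:R))%:E)%E]
      >= (1 - C1 * ((eps ^+ 2 + eps) * n%:R `^ (- (2 * rho))
                    + n%:R `^ (- (1 / 2) + delta n)))%:E)%E) /\
  (* Part (2) *)
  ((P.-integrable setT (EFin \o xi 0%N) /\ ('E_P[xi 0%N] = 0)%E /\
    P.-integrable setT (EFin \o (fun w => xi 0%N w ^+ 2))) ->
   exists (C0 C2 : R), 0 < C0 /\ 0 < C2 /\
   forall (eps rho : R), 0 < eps -> 0 < rho < 1 / 4 ->
   exists N : nat, forall n : nat, (N <= n)%N ->
     (P [set w | (kappa (circulant n (fun k => xi k w))
                  <= (C0 / eps * n%:R `^ (rho + 1 / 2) * ln n%:R)%:E)%E]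
      >= (1 - C2 * ((eps ^+ 2 + eps) * n%:R `^ (- (2 * rho))
                    + (Num.sqrt (ln n%:R))^-1))%:E)%E).
Proof.
move=> iid hH; split.
- move=> [ixi [Exi [_ [_ [t0 [t0_gt0 mgf]]]]]].
  have [A A_gt0 rate] := exists_large_dft_exp iid ixi Exi t0_gt0 mgf.
  have [C0 [C1 [C0_gt0 C1_gt0 kappa_le]]] := kappa_circulant_rate iid hH A_gt0 (ltr0n _ 4) rate.
  exists C0, C1; do 2!split=> //; exists (fun=> 0); split; first exact: cvg_cst.
  move=> eps rho eps_gt0 rho01; have [N kappa_le_N] := kappa_le eps rho eps_gt0 rho01.
  by exists N => n /kappa_le_N; rewrite addr0.
- move=> [ixi [Exi i2]]; have [B B_gt0 rate] := exists_large_dft_sqr iid ixi Exi i2.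
  have [C0 [C2 [C0_gt0 C2_gt0 kappa_le]]] := kappa_circulant_rate iid hH (ltr0n _ 3) B_gt0 rate.
  by exists C0, C2.
Qed.
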